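(* Let $g\in B_4$ be a non-identity braid and write $g=\Delta^{k}\sigma$ for the Garside normal form of $g$. If either $k\geq 0$ or $\sigma$ is a normal braid, then $g\notin \ker(\beta_4)$.
   Context: $B_4=\langle \sigma_1,\sigma_2,\sigma_3 : \sigma_1\sigma_2\sigma_1=\sigma_2\sigma_1\sigma_2,\ \sigma_2\sigma_3\sigma_2=\sigma_3\sigma_2\sigma_3,\ \sigma_1\sigma_3=\sigma_3\sigma_1\rangle$ is the braid group on four strands. The (reduced) Burau representation $\beta_4:B_4\to \mathrm{GL}_3(\mathbb{Z}[q^{\pm1}])$ is the homomorphism with $$\sigma_1\mapsto\begin{pmatrix} q&0&0\\-q&1&0\\0&0&1\end{pmatrix},\quad \sigma_2\mapsto\begin{pmatrix}1&1&0\\0&q&0\\0&-q&1\end{pmatrix},\quad \sigma_3\mapsto\begin{pmatrix}1&0&0\\0&1&1\\0&0&q\end{pmatrix}.$$ The Garside element is $\Delta=(\sigma_1\sigma_2\sigma_3)(\sigma_1\sigma_2)\sigma_1$. A positive braid is an element of the submonoid of $B_4$ generated by $\sigma_1,\sigma_2,\sigma_3$. Every $g\in B_4$ can be written uniquely as $g=\Delta^k\sigma$ with $k\in\mathbb{Z}$ and $\sigma$ a positive braid such that $\sigma\neq\Delta\tau$ for every positive braid $\tau$ (equivalently, $k$ is as large as possible); this expression is the Garside normal form of $g$. A product expansion of a positive braid $\sigma$ is an expression of $\sigma$ as a word in $\sigma_1,\sigma_2,\sigma_3$ (positive powers only; words are read from left to right; all expansions of $\sigma$ have the same length). The minimal form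 of $\sigma$ is the product expansion whose sequence of generator indices, read from left to right, is lexicographically minimal among all product expansions of $\sigma$. It is written $\sigma=\prod_{i=1}^n\sigma_1^{a_i}\sigma_3^{b_i}\sigma_2^{c_i}$ with $a_i,b_i,c_i\geq 0$, where $a_i+b_i>0$ for $2\leq i\leq n$ and $c_i>0$ for $1\leq i\leq n-1$. The positive braid $\sigma$, with minimal form $\sigma=\prod_{i=1}^n\sigma_1^{a_i}\sigma_3^{b_i}\sigma_2^{c_i}$ (where $a_i,b_i,c_i\geq 0$, $a_i+b_i>0$ for $2\leq i\leq n$ and $c_i>0$ for $1\leq i\leq n-1$), is a normal braid if the following hold for each $p<n$ (a clause involving the index $p-1$ is imposed only when $p\geq 2$): (i) If $a_p=0$ and $b_p=1$, then $c_p\neq 1,2$. If $a_p=0$, $b_p=1$ and $a_{p-1}+1\geq c_p$, then $c_{p-1}\neq 1$. (ii) If $b_p>0$, $a_p\geq b_p+1$ and $c_p=1$, then $a_{p+1}\neq 2$. If $a_p=1$, $b_p=1$ and $c_p=1$, then $a_{p+1}\neq 2$. *)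

(* Defs.v *)
From HB Require Import structures.
From mathcomp Require Import all_boot all_order all_algebra ring boolp.

Set Implicit Arguments.
Unset Strict Implicit.
Unset Printing Implicit Defensive.

Import Order.TTheory GRing.Theory Num.Theory.
Local Open Scope quotient_scope.
Local Open Scope group_scope.

Definition s1 : 'I_3 := @Ordinal 3 0 isT.
Definition s2 : 'I_3 := @Ordinal 3 1 isT.
Definition s3 : 'I_3 := @Ordinal 3 2 isT.

Lemma I3P (P : 'I_3 -> Prop) : P s1 -> P s2 -> P s3 -> forall i, P i.
Proof.
by move=> P1 P2 P3 [[|[|[|//]]] h]; [move: P1|move: P2|move: P3];
  congr P; apply: val_inj.
Qed.

(* Group words in the generators: the letter (i, false) is the i-th generator
   and (i, true) is its inverse. *)
Definition gword := seq ('I_3 * bool).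

Inductive braid_cong : gword -> gword -> Prop :=
| braid_refl u : braid_cong u u
| braid_sym u v : braid_cong u v -> braid_cong v u
| braid_trans v u w : braid_cong u v -> braid_cong v w -> braid_cong u w
| braid_cat u u' v v' :
    braid_cong u u' -> braid_cong v v' -> braid_cong (u ++ v) (u' ++ v')
| braid_cancel i b : braid_cong [:: (i, b); (i, ~~ b)] [::]
| braid_rel12 : braid_cong [:: (s1, false); (s2, false); (s1, false)]
                           [:: (s2, false); (s1, false); (s2, false)]
| braid_rel23 : braid_cong [:: (s2, false); (s3, false); (s2, false)]
                           [:: (s3, false); (s2, false); (s3, false)]
| braid_rel13 : braid_cong [:: (s1, false); (s3, false)]
                           [:: (s3, false); (s1, false)].

Definition braid_congb : rel gword := fun u v => `[< braid_cong u v >].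

Lemma braid_congb_refl : reflexive braid_congb.
Proof. by move=> u; apply/asboolP; exact: braid_refl. Qed.
Lemma braid_congb_sym : symmetric braid_congb.
Proof. by move=> u v; apply/asboolP/asboolP; exact: braid_sym. Qed.
Lemma braid_congb_trans : transitive braid_congb.
Proof.
by move=> v u w /asboolP uv /asboolP vw; apply/asboolP; exact: braid_trans vw.
Qed.
Canonical braid_equiv :=
  EquivRel braid_congb braid_congb_refl braid_congb_sym braid_congb_trans.

Definition B4 := {eq_quot braid_equiv}.
HB.instance Definition _ : EqQuotient _ braid_equiv B4 := EqQuotient.on B4.
HB.instance Definition _ := Choice.on B4.

Definition braid_of (u : gword) : B4 := \pi_B4 u.

Lemma braid_of_eq u v : braid_of u = braid_of v <-> braid_cong u v.
Proof. by split=> [/eqmodP/asboolP|uv] //; apply/eqmodP/asboolP. Qed.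

Lemma braid_ofK (x : B4) : braid_of (repr x) = x.
Proof. exact: reprK. Qed.

Lemma repr_braid_of u : braid_cong (repr (braid_of u)) u.
Proof. by apply/braid_of_eq; rewrite braid_ofK. Qed.

Definition gword_inv (u : gword) : gword := rev [seq (x.1, ~~ x.2) | x <- u].

Lemma gword_invP u : braid_cong (u ++ gword_inv u) [::].
Proof.
elim: u => [|[i b] u IH]; first exact: braid_refl.
rewrite /gword_inv /= rev_cons -cats1 catA.
apply: (braid_trans (v := [:: (i, b)] ++ [::] ++ [:: (i, ~~ b)])).
  exact: (braid_cat (braid_refl [:: (i, b)]) (braid_cat IH (braid_refl _))).
exact: braid_cancel.
Qed.

Lemma gword_invK : involutive gword_inv.
Proof.
move=> u; rewrite /gword_inv map_rev revK -map_comp -[RHS]map_id.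
by apply: eq_map => -[i b] /=; rewrite negbK.
Qed.

Lemma gword_inv_cong u v :
  braid_cong u v -> braid_cong (gword_inv u) (gword_inv v).
Proof.
move=> uv; apply: (braid_trans (v := gword_inv u ++ v ++ gword_inv v)).
  rewrite -{1}[gword_inv u]cats0; apply: braid_cat; first exact: braid_refl.
  exact/braid_sym/gword_invP.
rewrite catA -{2}[gword_inv v]cat0s; apply: braid_cat; last exact: braid_refl.
apply: (braid_trans (v := gword_inv u ++ u)).
  by apply: braid_cat; [exact: braid_refl | exact: braid_sym].
by rewrite -{2}[u]gword_invK; exact: gword_invP.
Qed.

Definition B4_one : B4 := braid_of [::].
Definition B4_mul (x y : B4) : B4 := braid_of (repr x ++ repr y).
Definition B4_inv (x : B4) : B4 := braid_of (gword_inv (repr x)).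

Lemma B4_mulE u v : B4_mul (braid_of u) (braid_of v) = braid_of (u ++ v).
Proof. by apply/braid_of_eq/braid_cat; exact: repr_braid_of. Qed.

Lemma B4_invE u : B4_inv (braid_of u) = braid_of (gword_inv u).
Proof. exact/braid_of_eq/gword_inv_cong/repr_braid_of. Qed.

Lemma B4_mulA : associative B4_mul.
Proof.
move=> x y z; rewrite -[x]braid_ofK -[y]braid_ofK -[z]braid_ofK.
by rewrite !B4_mulE catA.
Qed.
Lemma B4_mul1 : left_id B4_one B4_mul.
Proof. by move=> x; rewrite -[x]braid_ofK B4_mulE. Qed.
Lemma B4_mulr1 : right_id B4_one B4_mul.
Proof. by move=> x; rewrite -[x]braid_ofK B4_mulE cats0. Qed.
Lemma B4_mulV : left_inverse B4_one B4_inv B4_mul.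
Proof.
move=> x; rewrite -[x]braid_ofK B4_invE B4_mulE.
by apply/braid_of_eq; rewrite -{2}[repr x]gword_invK; exact: gword_invP.
Qed.
Lemma B4_mulrV : right_inverse B4_one B4_inv B4_mul.
Proof.
move=> x; rewrite -[x]braid_ofK B4_invE B4_mulE.
by apply/braid_of_eq; exact: gword_invP.
Qed.

HB.instance Definition _ :=
  isGroup.Build B4 B4_mulA B4_mul1 B4_mulr1 B4_mulV B4_mulrV.

Definition sigma (i : 'I_3) : B4 := braid_of [:: (i, false)].

Lemma braid_of_cat u v : braid_of (u ++ v) = braid_of u * braid_of v.
Proof. by rewrite -B4_mulE. Qed.

Lemma sigma_inv i : (sigma i)^-1 = braid_of [:: (i, true)].
Proof. exact: B4_invE. Qed.

Lemma sigma12 : sigma s1 * sigma s2 * sigma s1 = sigma s2 * sigma s1 * sigma s2.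
Proof.
by rewrite /sigma -!braid_of_cat; apply/braid_of_eq; exact: braid_rel12.
Qed.
Lemma sigma23 : sigma s2 * sigma s3 * sigma s2 = sigma s3 * sigma s2 * sigma s3.
Proof.
by rewrite /sigma -!braid_of_cat; apply/braid_of_eq; exact: braid_rel23.
Qed.
Lemma sigma13 : sigma s1 * sigma s3 = sigma s3 * sigma s1.
Proof.
by rewrite /sigma -!braid_of_cat; apply/braid_of_eq; exact: braid_rel13.
Qed.

Section Lift.
Variables (G : groupType) (a : 'I_3 -> G).

Definition braid_lift (x : B4) : G :=
  \prod_(l <- repr x) (if l.2 then (a l.1)^-1 else a l.1).

Hypotheses (a12 : a s1 * a s2 * a s1 = a s2 * a s1 * a s2)
  (a23 : a s2 * a s3 * a s2 = a s3 * a s2 * a s3)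
  (a13 : a s1 * a s3 = a s3 * a s1).

Lemma braid_liftE u :
  braid_lift (braid_of u) = \prod_(l <- u) (if l.2 then (a l.1)^-1 else a l.1).
Proof.
rewrite /braid_lift; move: (repr _) (repr_braid_of u) => w.
elim=> {w u} //.
- by move=> v u w _ -> _ ->.
- by move=> u u' v v' _ Hu _ Hv; rewrite !big_cat Hu Hv.
- by move=> i [] /=; rewrite !big_cons big_nil /= mulg1 ?mulVg ?mulgV.
- by rewrite !big_cons !big_nil /= !mulg1 !mulgA.
- by rewrite !big_cons !big_nil /= !mulg1 !mulgA.
- by rewrite !big_cons !big_nil /= !mulg1.
Qed.

Lemma braid_lift_gen i : braid_lift (sigma i) = a i.
Proof. by rewrite braid_liftE big_seq1. Qed.

Lemma braid_liftM : {morph braid_lift : x y / x * y}.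
Proof.
move=> x y; rewrite -[x]braid_ofK -[y]braid_ofK -braid_of_cat.
by rewrite !braid_liftE big_cat.
Qed.
End Lift.

Definition expgz (G : groupType) (x : G) (k : int) : G :=
  match k with Posz n => x ^+ n | Negz n => x ^- n.+1 end.

Definition Delta : B4 :=
  (sigma s1 * sigma s2 * sigma s3) * (sigma s1 * sigma s2) * sigma s1.

Definition pos_braid (w : seq 'I_3) : B4 := \prod_(i <- w) sigma i.

Definition positive_braid (x : B4) : Prop := exists w, x = pos_braid w.

Definition garside_normal_form (g : B4) (k : int) (x : B4) : Prop :=
  [/\ g = expgz Delta k * x, positive_braid x
    & forall t, positive_braid t -> x <> Delta * t].

Definition minimal_form (x : B4) (w : seq 'I_3) : Prop :=
  pos_braid w = x /\
  forall w', pos_braid w' = x -> ((w : seqlexi 'I_3) <= w')%O.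

Section Normal.
Local Open Scope nat_scope.

(* The blocks are indexed from 1 to n; values of a, b, c elsewhere are
   irrelevant. *)
Definition block_word (n : nat) (a b c : nat -> nat) : seq 'I_3 :=
  flatten [seq nseq (a i) s1 ++ nseq (b i) s3 ++ nseq (c i) s2 | i <- iota 1 n].

Definition normal_braid (x : B4) : Prop :=
  exists (n : nat) (a b c : nat -> nat),
  [/\ minimal_form x (block_word n a b c),
      forall i, 2 <= i <= n -> 0 < a i + b i,
      forall i, 1 <= i < n -> 0 < c i
    & forall p, 1 <= p < n ->
      [/\ a p = 0 -> b p = 1 -> c p <> 1 /\ c p <> 2,
          2 <= p -> a p = 0 -> b p = 1 -> c p <= a p.-1 + 1 -> c p.-1 <> 1,
          0 < b p -> b p + 1 <= a p -> c p = 1 -> a p.+1 <> 2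
        & a p = 1 -> b p = 1 -> c p = 1 -> a p.+1 <> 2]].
End Normal.

Section Laurent.
Local Open Scope ring_scope.
Local Notation frac := {fraction {poly int}}.
Local Notation "p %:F" := (@FracField.tofrac {poly int} p).

(* Laurent polynomials over the integers, as the subring of the field of
   fractions of {poly int} formed by the p / 'X^n. *)
Definition is_laurent : {pred frac} :=
  fun x => `[< exists (p : {poly int}) (n : nat), x = p%:F / ('X^n)%:F >].

Lemma is_laurentP x :
  reflect (exists (p : {poly int}) (n : nat), x = p%:F / ('X^n)%:F)
          (x \in is_laurent).
Proof. exact: asboolP. Qed.

Lemma tofracXn_neq0 n : ('X^n)%:F != 0.
Proof. by rewrite tofrac_eq0 monic_neq0 ?monicXn. Qed.

Lemma is_laurent_subring : subring_closed is_laurent.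
Proof.
split=> [|x y|x y].
- by apply/is_laurentP; exists 1, 0; rewrite expr0 divff ?tofrac1 ?oner_neq0.
- move=> /is_laurentP[p [m ->]] /is_laurentP[r [n ->]]; apply/is_laurentP.
  exists (p * 'X^n - r * 'X^m), (m + n)%N.
  rewrite -mulNr addf_div ?tofracXn_neq0 // exprD tofracB !tofracM.
  by rewrite mulNr.
- move=> /is_laurentP[p [m ->]] /is_laurentP[r [n ->]]; apply/is_laurentP.
  by exists (p * r), (m + n)%N; rewrite mulf_div exprD !tofracM.
Qed.

HB.instance Definition _ := GRing.isSubringClosed.Build frac is_laurent
  is_laurent_subring.

Record laurent := Laurent {laurent_val : frac; _ : laurent_val \in is_laurent}.
HB.instance Definition _ := [isSub for laurent_val].
HB.instance Definition _ := [Choice of laurent by <:].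
HB.instance Definition _ := [SubChoice_isSubComNzRing of laurent by <:].

Definition laurent_unit : pred laurent :=
  fun x => (val x != 0) && ((val x)^-1 \in is_laurent).
Definition laurent_inv (x : laurent) : laurent := insubd x (val x)^-1.

Lemma laurent_mulVx : {in laurent_unit, left_inverse 1 laurent_inv *%R}.
Proof.
move=> x /andP[x0 xV]; apply: val_inj.
have -> : val (laurent_inv x * x) = val (laurent_inv x) * val x by [].
by rewrite val_insubd xV mulVf.
Qed.

Lemma laurent_unitP (x y : laurent) : y * x = 1 -> laurent_unit x.
Proof.
move/(congr1 val) => yx1; have {}yx1 : val y * val x = 1 by exact: yx1.
have x0 : val x != 0.
  by apply: contra_eq_neq yx1 => ->; rewrite mulr0 eq_sym oner_neq0.
apply/andP; split=> //.
have -> : (val x)^-1 = val y by apply: (mulIf x0); rewrite mulVf.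
exact: valP.
Qed.

Lemma laurent_inv_out : {in [predC laurent_unit], laurent_inv =1 id}.
Proof.
move=> x; rewrite !inE => xNU; apply: val_inj; rewrite val_insubd.
case: ifP => // xV; move: xNU; rewrite -topredE /= /laurent_unit xV andbT negbK.
by move=> /eqP ->; rewrite invr0.
Qed.

HB.instance Definition _ := GRing.ComNzRing_hasMulInverse.Build laurent
  laurent_mulVx laurent_unitP laurent_inv_out.

Lemma q_subproof : ('X : {poly int})%:F \in is_laurent.
Proof. by apply/is_laurentP; exists 'X, 0; rewrite expr0 tofrac1 divr1. Qed.

Definition q : laurent := Laurent q_subproof.

Lemma q_unit : q \is a GRing.unit.
Proof.
apply/andP; split; first by rewrite /= -['X]expr1 tofracXn_neq0.
by apply/is_laurentP; exists 1, 1; rewrite expr1 tofrac1 div1r.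
Qed.
End Laurent.

Section GL.
Local Open Scope ring_scope.
Variables (R : comUnitRingType) (n : nat).

Record GL := GLmx {GL_mx :> 'M[R]_n; _ : GL_mx \in unitmx}.
HB.instance Definition _ := [isSub for GL_mx].
HB.instance Definition _ := [Choice of GL by <:].

Lemma GL_unit (A : GL) : (A : 'M_n) \in unitmx. Proof. exact: valP. Qed.

Lemma GL_mul_subproof (A B : GL) : A *m B \in unitmx.
Proof. by rewrite unitmx_mul !GL_unit. Qed.
Lemma GL_inv_subproof (A : GL) : invmx A \in unitmx.
Proof. by rewrite unitmx_inv GL_unit. Qed.

Definition GL_one := GLmx (unitmx1 R n).
Definition GL_mul A B := GLmx (GL_mul_subproof A B).
Definition GL_inv A := GLmx (GL_inv_subproof A).

Lemma GL_mulA : associative GL_mul.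
Proof. by move=> A B C; apply: val_inj; exact: mulmxA. Qed.
Lemma GL_mul1 : left_id GL_one GL_mul.
Proof. by move=> A; apply: val_inj; exact: mul1mx. Qed.
Lemma GL_mulr1 : right_id GL_one GL_mul.
Proof. by move=> A; apply: val_inj; exact: mulmx1. Qed.
Lemma GL_mulV : left_inverse GL_one GL_inv GL_mul.
Proof. by move=> A; apply: val_inj; exact: mulVmx (GL_unit A). Qed.
Lemma GL_mulrV : right_inverse GL_one GL_inv GL_mul.
Proof. by move=> A; apply: val_inj; exact: mulmxV (GL_unit A). Qed.

HB.instance Definition _ :=
  isGroup.Build GL GL_mulA GL_mul1 GL_mulr1 GL_mulV GL_mulrV.
End GL.

Section Burau.
Local Open Scope ring_scope.

Definition burau_rows (i : 'I_3) : seq (seq laurent) :=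
  nth [::] [:: [:: [:: q; 0; 0]; [:: - q; 1; 0]; [:: 0; 0; 1]];
               [:: [:: 1; 1; 0]; [:: 0; q; 0]; [:: 0; - q; 1]];
               [:: [:: 1; 0; 0]; [:: 0; 1; 1]; [:: 0; 0; q]]] i.

Definition burau_mx (i : 'I_3) : 'M[laurent]_3 :=
  \matrix_(r, c) nth 0 (nth [::] (burau_rows i) r) c.

Lemma burau_mx_unit i : burau_mx i \in unitmx.
Proof.
suff E : \det (burau_mx i) = q by rewrite unitmxE E q_unit.
rewrite (expand_det_row _ 0) !big_ord_recl big_ord0 /cofactor.
rewrite !(expand_det_row _ (0 : 'I_2)) !big_ord_recl !big_ord0 /cofactor.
by rewrite !det_mx11 !mxE; elim/I3P: i => /=; ring.
Qed.

Definition burau_gen (i : 'I_3) : GL laurent 3 := GLmx (burau_mx_unit i).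

Lemma burau_gen12 :
  (burau_gen s1 * burau_gen s2 * burau_gen s1 =
   burau_gen s2 * burau_gen s1 * burau_gen s2)%g.
Proof.
apply: val_inj; apply/matrixP => r c.
rewrite !mxE !big_ord_recl !big_ord0 !mxE !big_ord_recl !big_ord0 !mxE.
by elim/I3P: r; elim/I3P: c => /=; ring.
Qed.

Lemma burau_gen23 :
  (burau_gen s2 * burau_gen s3 * burau_gen s2 =
   burau_gen s3 * burau_gen s2 * burau_gen s3)%g.
Proof.
apply: val_inj; apply/matrixP => r c.
rewrite !mxE !big_ord_recl !big_ord0 !mxE !big_ord_recl !big_ord0 !mxE.
by elim/I3P: r; elim/I3P: c => /=; ring.
Qed.

Lemma burau_gen13 :
  (burau_gen s1 * burau_gen s3 = burau_gen s3 * burau_gen s1)%g.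
Proof.
apply: val_inj; apply/matrixP => r c.
rewrite !mxE !big_ord_recl !big_ord0 !mxE.
by elim/I3P: r; elim/I3P: c => /=; ring.
Qed.

Definition burau : B4 -> GL laurent 3 := braid_lift burau_gen.

Lemma burauM : {morph burau : x y / (x * y)%g}.
Proof. exact: braid_liftM burau_gen12 burau_gen23 burau_gen13. Qed.

Lemma burau1 : burau 1%g = 1%g.
Proof. by apply: (mulgI (burau 1%g)); rewrite -burauM !mulg1. Qed.

HB.instance Definition _ :=
  isMultiplicative.Build B4 (GL laurent 3) burau burauM.
HB.instance Definition _ :=
  Multiplicative_isUMagmaMorphism.Build B4 (GL laurent 3) burau burau1.

Lemma burau_sigma i : burau (sigma i) = burau_mx i :> 'M_3.
Proof.
by rewrite /burau (braid_lift_gen burau_gen12 burau_gen23 burau_gen13).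
Qed.
End Burau.

(* Main.v *)
(* Let k < 0. If burau g = 1 then burau sigma is a power of burau Delta, whose
   matrix is antidiagonal; so the outer rows of burau sigma have their only
   nonzero entry in an outer column, and its middle row is a multiple of e2. A
   row vector (x, y, z) is followed through the blocks s1^a s3^b s2^c of the
   minimal form. As a rule y acquires a degree larger than those of x and z,
   and the next block multiplies its leading term by a monomial and a nonzero
   integer. Cancellations of leading terms come from short blocks only. Some of
   these produce a factor, such as s2 s1 s2 or s3 s2 s1^k s3, that a minimal
   form does not have; the others are excluded by the conditions on normal
   braids or by the fact that Delta does not divide sigma. Hence y is nonzero at
   the end, or x and z both are, if one starts from the right one of e1 and e3.
   The prefixes s1^a s2 (s1 s3 s2^2)^j never enter this regime: they only
   exchange the vectors (1, 1, 0) and (0, -q, 1). A word that ends before it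
   leaves them may need the middle row, evaluated at q = 1. The case k >= 0
   follows from the determinant, which is q to the length. *)

Require Import Defs.
From mathcomp Require Import all_boot all_order all_algebra.
From mathcomp Require Import zify ring.
From mathcomp Require boolp.

Set Implicit Arguments.
Unset Strict Implicit.
Unset Printing Implicit Defensive.

Import Order.TTheory GRing.Theory Num.Theory.
Local Open Scope ring_scope.

(** * Leading terms *)

Section LeadingTerms.
Implicit Types (f g u t x y z : {poly int}) (d e r s : int).

Definition coefz f d : int := if d is Posz n then f`_n else 0.

(* Degrees are integers because [Y - 3] below may be negative. *)
Definition small f d := forall e, d < e -> coefz f e = 0.
(** Here [r] may be 0, so that leading terms can be added first and their cancellation examined
    afterwards. *)
Definition lead f d r := small f d /\ coefz f d = r.

Lemma coefzD f g d : coefz (f + g) d = coefz f d + coefz g d.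
Proof. by case: d => n /=; rewrite ?coefD ?addr0. Qed.

Lemma coefzN f d : coefz (- f) d = - coefz f d.
Proof. by case: d => n /=; rewrite ?coefN ?oppr0. Qed.

Lemma coefzXM f d : coefz ('X * f) (d + 1) = coefz f d.
Proof.
have [[n ->]|[->|[n ->]]] : (exists n : nat, d = n) \/ d = - 1 \/
    exists n : nat, d = Negz n.+1.
- by case: d => [n|[|n]];
    [left; exists n | right; left | right; right; exists n].
- by rewrite (_ : Posz n + 1 = Posz n.+1) /= ?coefXM //; lia.
- by rewrite /= coefXM.
- by rewrite (_ : Negz n.+1 + 1 = Negz n) //; lia.
Qed.

Lemma small_lead f d : small f d -> lead f d (coefz f d).
Proof. by []. Qed.

Lemma lead_small f d r : lead f d r -> small f d.
Proof. by case. Qed.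

Lemma small_le f d e : small f d -> d <= e -> small f e.
Proof. by move=> h de k ek; apply: h; exact: le_lt_trans ek. Qed.

Lemma small_lead0 f d e : small f d -> d < e -> lead f e 0.
Proof. by move=> h de; split; [exact: small_le h (ltW de) | exact: h]. Qed.

Lemma lead_le f d r e : lead f d r -> d <= e -> small f e.
Proof. by case=> h _; exact: small_le. Qed.

Lemma lead_lt f d r e : lead f d r -> d < e -> lead f e 0.
Proof. by case=> h _; exact: small_lead0. Qed.

Lemma lead_cast f d r d' r' : lead f d r -> d = d' -> r = r' -> lead f d' r'.
Proof. by move=> h <- <-. Qed.

Lemma small0 d : small 0 d.
Proof. by move=> [n|n] _ /=; rewrite ?coef0. Qed.

Lemma lead0 d : lead 0 d 0.
Proof. by split; [exact: small0 | case: d => n /=; rewrite ?coef0]. Qed.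

Lemma leadXn n : lead 'X^n n%:Z 1.
Proof.
split=> [[m|m]|] //=; rewrite coefXn ?eqxx // => nm.
by case: eqP => // E; rewrite E ltxx in nm.
Qed.

Lemma leadD f g d r s : lead f d r -> lead g d s -> lead (f + g) d (r + s).
Proof.
move=> [hf <-] [hg <-]; split; last by rewrite coefzD.
by move=> e de; rewrite coefzD hf ?hg.
Qed.

Lemma leadN f d r : lead f d r -> lead (- f) d (- r).
Proof.
by move=> [hf <-]; split=> [e de|]; rewrite coefzN // hf ?oppr0.
Qed.

Lemma leadXM f d r : lead f d r -> lead ('X * f) (d + 1) r.
Proof.
move=> [hf <-]; split=> [e de|]; last by rewrite coefzXM.
by rewrite -[e](subrK 1) coefzXM hf //; lia.
Qed.

Lemma smallD f g d : small f d -> small g d -> small (f + g) d.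
Proof. by move=> hf hg e de; rewrite coefzD hf ?hg. Qed.

Lemma smallN f d : small f d -> small (- f) d.
Proof. by move=> hf e de; rewrite coefzN hf ?oppr0. Qed.

Lemma smallXM f d : small f d -> small ('X * f) (d + 1).
Proof. by move=> /small_lead /leadXM []. Qed.

Lemma lead_neq0 f d r : lead f d r -> r != 0 -> f != 0.
Proof.
by move=> [_ <-]; apply: contraNneq => ->; case: d => n //=; rewrite coef0.
Qed.

(** This is $[n]_q u + q^n t$ with ['X] for $q$, the effect of the [n]-th power of a generator on
    the one coordinate that it changes. *)
Definition aff n u t : {poly int} := iter n (fun w => u + 'X * w) t.
#[global] Arguments aff : simpl never.

Lemma affSr n u t : aff n.+1 u t = aff n u (u + 'X * t).
Proof. exact: iterSr. Qed.

Lemma lead_aff n u t d r s : (0 < n)%N ->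
  lead u (d + 1) s -> lead t d r -> lead (aff n u t) (d + n%:Z) (s + r).
Proof.
case: n => // n _ hu ht; elim: n => [|n IH].
  exact: leadD hu (leadXM ht).
have hu0 : lead u (d + n.+1%:Z + 1) 0 by apply: lead_lt hu _; lia.
rewrite /aff iterS.
by apply: lead_cast (leadD hu0 (leadXM IH)) _ _; [lia | exact: add0r].
Qed.
End LeadingTerms.

(** * Effect of one block *)

Record vec := Vec {vx : {poly int}; vy : {poly int}; vz : {poly int}}.

(* The product of [v] with the Burau matrix of s1^a s3^b s2^c. *)
Definition block (a b c : nat) (v : vec) : vec :=
  let x := aff a (- 'X * vy v) (vx v) in
  let z := aff b (vy v) (vz v) in
  Vec x (aff c (x - 'X * z) (vy v)) z.

Section Block.
Implicit Types (v : vec) (x y z : {poly int}) (d r s Y D eta tau : int).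

Lemma lead_blocky c x y z d r s eta : (0 < c)%N ->
  lead x (d + 1) r -> lead z d s -> lead y d eta ->
  lead (aff c (x - 'X * z) y) (d + c%:Z) (r - s + eta).
Proof.
move=> c0 hx hz hy; apply: lead_aff => //.
by apply: leadD => //; apply: leadN; exact: leadXM.
Qed.

Lemma lead_blockx a x y d r eta : (0 < a)%N ->
  lead x d r -> lead y d eta ->
  lead (aff a (- 'X * y) x) (d + a%:Z) (r - eta).
Proof.
move=> a0 hx hy; rewrite [r - _]addrC; apply: lead_aff => //.
by rewrite mulNr; apply: leadN; exact: leadXM.
Qed.

Lemma lead_blockz b y z d s eta : (0 < b)%N ->
  lead z d s -> lead y (d + 1) eta -> lead (aff b y z) (d + b%:Z) (eta + s).
Proof. by move=> b0 hz hy; exact: lead_aff. Qed.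

(* [v] is not a multiple of e1 or of e3. *)
Definition nonmono v := vy v != 0 \/ vx v != 0 /\ vz v != 0.

Lemma low_x a x y Y eta : small x (Y - 1) -> lead y Y eta ->
  ((0 < a)%N -> lead (aff a (- 'X * y) x) (Y + a%:Z) (- eta)) /\
  (forall D : int, Y - 1 <= D -> Y + a%:Z <= D -> small (aff a (- 'X * y) x) D).
Proof.
move=> hx hy; have hx0 : lead x Y 0 by apply: small_lead0 hx _; lia.
case: a => [|a]; first by split=> // D h1 h2; exact: small_le hx _.
have h : lead (aff a.+1 (- 'X * y) x) (Y + a.+1%:Z) (- eta).
  by rewrite -[- eta]sub0r; exact: lead_blockx.
by split=> // D h1 h2; exact: lead_le h _.
Qed.

Lemma low_z b y z Y eta : small z (Y - 2) -> lead y Y eta ->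
  ((0 < b)%N -> lead (aff b y z) (Y + b%:Z - 1) eta) /\
  (forall D : int, Y - 2 <= D -> ((0 < b)%N -> Y + b%:Z - 1 <= D) ->
     small (aff b y z) D).
Proof.
move=> hz hy; case: b => [|b].
  by split=> // D h1 h2; exact: small_le hz _.
have h : lead (aff b.+1 y z) (Y + b.+1%:Z - 1) eta.
  have hz0 : lead z (Y - 1) 0 by apply: small_lead0 hz _; lia.
  have hy1 : lead y (Y - 1 + 1) eta by rewrite subrK.
  by apply: lead_cast (lead_blockz _ hz0 hy1) _ _; [|lia|rewrite addr0].
by split=> // D h1 h2; exact: lead_le h (h2 _).
Qed.

Definition top_coef (a b : nat) eta : int :=
  if (a == b) && (1 < a)%N then - eta - eta else - eta.

(** Three terms compete for the top degree: the new x and $-qz$, each with [- eta], and $qy$ with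
    [eta], which counts only if [maxn a b = 1]. They cancel for the two excluded pairs. *)
Lemma low_y a b c v Y eta : lead (vy v) Y eta ->
  small (vx v) (Y - 1) -> small (vz v) (Y - 2) ->
  (0 < a + b)%N -> (a, b) != (1, 0)%N -> (a, b) != (0, 1)%N -> (0 < c)%N ->
  lead (vy (block a b c v)) (Y + (maxn a b)%:Z + c%:Z - 1) (top_coef a b eta).
Proof.
move: v => [x y z] /= hy hx hz ab0 n10 n01 c0.
have [hx1 hx2] := low_x a hx hy; have [hz1 hz2] := low_z b hz hy.
set M := maxn a b; pose d := Y + M%:Z - 1.
have M0 : (0 < M)%N by rewrite /M; lia.
have hX : lead (aff a (- 'X * y) x) (d + 1) (if (b <= a)%N then - eta else 0).
  case: leqP => ab.
    by apply: lead_cast (hx1 _) _ _ => //; rewrite /d /M; lia.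
  have h : small (aff a (- 'X * y) x) (d : int).
    by apply: hx2; rewrite /d /M; lia.
  by apply: small_lead0 h _; lia.
have hZ : lead (aff b y z) d (if (a <= b)%N then eta else 0).
  case: leqP => ab.
    by apply: lead_cast (hz1 _) _ _ => //; rewrite /d /M; lia.
  have h : small (aff b y z) (d - 1) by apply: hz2 => *; rewrite /d /M; lia.
  by apply: small_lead0 h _; lia.
have hY : lead y d (if M == 1%N then eta else 0).
  case: eqP => M1; first by apply: lead_cast hy _ _; rewrite /d ?M1 //; lia.
  by apply: lead_lt hy _; rewrite /d; lia.
apply: lead_cast (lead_blocky c0 hX hZ hY) _ _; first by rewrite /d; lia.
rewrite /top_coef.
have [a1|a1|a1] := ltngtP a b.
- have -> : (M == 1%N) = false.
    by apply/eqP => M1; move/eqP: n01; case; congr pair; rewrite /M in M1; lia.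
  by rewrite /=; lia.
- have -> : (M == 1%N) = false.
    by apply/eqP => M1; move/eqP: n10; case; congr pair; rewrite /M in M1; lia.
  by rewrite /=; lia.
- by rewrite /M -a1 maxnn /=; case: (ltngtP a 1%N) => ? /=; lia.
Qed.

Lemma top_coef_neq0 a b eta : eta != 0 -> top_coef a b eta != 0.
Proof. by rewrite /top_coef; case: ifP => _; lia. Qed.

Lemma aff_neq0_x a x y Y eta : eta != 0 -> small x (Y - 1) -> lead y Y eta ->
  (0 < a)%N -> aff a (- 'X * y) x != 0.
Proof.
move=> eta0 hx hy a0; have [h _] := low_x a hx hy.
by apply: lead_neq0 (h a0) _; rewrite oppr_eq0.
Qed.

Lemma block1_sub a b v : let v' := block a b 1 v in
  vx v' - vy v' = 'X * (vz v' - vy v).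
Proof. by rewrite /= /aff /=; ring. Qed.

(** After a single s2, $x' - y' = q(z' - y)$, so the degree is read off z. This prepares
    [GoodCancel], where x and y have the same leading term. *)
Lemma low_diff a b v Y eta : eta != 0 -> lead (vy v) Y eta ->
  small (vx v) (Y - 1) -> small (vz v) (Y - 2) ->
  (0 < b)%N -> (b < a)%N \/ [/\ a = 1, b = 1 & small (vz v) (Y - 3)]%N ->
  let v' := block a b 1 v in
  exists2 delta, delta != top_coef a b eta &
    lead (vx v' - vy v') (Y + (maxn a b)%:Z - 1) delta.
Proof.
move=> eta0 hy hx hz b0 hab v'; rewrite block1_sub {}/v' /=.
have tE : top_coef a b eta = - eta.
  rewrite /top_coef; case: ifP => // /andP[/eqP ab a1].
  by case: hab => [|[]]; lia.
have [hz1 hz2] := low_z b hz hy.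
have [b1|b1] : b = 1%N \/ (1 < b)%N by lia.
  (* For [b = 1], $z' - y = qz$; when also [a = 1], the degree drops far enough because z has degree
     at most [Y - 3]. *)
  exists 0; first by rewrite tE; lia.
  have -> : aff b (vy v) (vz v) - vy v = 'X * vz v by rewrite b1 /aff /=; ring.
  case: hab => [ab|[a1 _ hz3]].
    have h := smallXM (smallXM hz); apply: small_lead0 h _; lia.
  have h := smallXM (smallXM hz3); apply: small_lead0 h _; rewrite a1 b1; lia.
have ab : (b < a)%N by case: hab => [//|[]]; lia.
have hz' : lead (aff b (vy v) (vz v) - vy v) (Y + b%:Z - 1) eta.
  rewrite -[X in lead _ _ X]subr0; apply: leadD; first exact: hz1.
  by apply: leadN; apply: lead_lt hy _; lia.
have hX := leadXM hz'; have [ba|ba] : a = b.+1 \/ (b.+1 < a)%N by lia.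
  by exists eta; [rewrite tE; lia | apply: lead_cast hX _ _ => //; lia].
by exists 0; [rewrite tE; lia | apply: lead_lt hX _; lia].
Qed.

Lemma blocky_b0 a c v D r : r != 0 -> (0 < c)%N ->
  lead (aff a (- 'X * vy v) (vx v)) (D + 1) r ->
  small (vz v) (D - 2) -> small (vy v) (D - 1) ->
  lead (vy (block a 0 c v)) (D + c%:Z) r.
Proof.
move=> r0 c0 hx hz hy.
have hz0 : lead (vz v) D 0 by apply: small_lead0 hz _; lia.
have hy0 : lead (vy v) D 0 by apply: small_lead0 hy _; lia.
by apply: lead_cast (lead_blocky c0 hx hz0 hy0) _ _ => //; lia.
Qed.

Lemma blocky_a0 b c v Y eta : (1 < b)%N -> (0 < c)%N ->
  lead (vy v) Y eta -> small (vx v) Y -> small (vz v) (Y - 2) ->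
  lead (vy (block 0 b c v)) (Y + b%:Z + c%:Z - 1) (- eta).
Proof.
move=> b1 c0 hy hx hz; have [/(_ (ltnW b1)) hz1 _] := low_z b hz hy.
have hx0 : lead (vx v) (Y + b%:Z - 1 + 1) 0 by apply: small_lead0 hx _; lia.
have hy0 : lead (vy v) (Y + b%:Z - 1) 0 by apply: lead_lt hy _; lia.
by apply: lead_cast (lead_blocky c0 hx0 hz1 hy0) _ _ => //; lia.
Qed.

(** The first s2 replaces y by $x - q(y + qz) + qy = x - q^2 z$, which has lost the leading term. A
    second s2 brings it back through $-qz'$. *)
Lemma blocky_01 c v Y eta : (1 < c)%N ->
  lead (vy v) Y eta -> small (vx v) (Y - 1) -> small (vz v) (Y - 3) ->
  lead (vy (block 0 1 c v)) (Y + c%:Z - 1) (- eta).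
Proof.
case: c => [|[|c]] // _ hy hx hz.
set z' := aff 1 (vy v) (vz v).
have hz' : lead z' Y eta.
  rewrite /z' /aff /= -[eta]addr0; apply: leadD => //.
  by have h := smallXM hz; apply: small_lead0 h _; lia.
have hy1 : lead (vx v - 'X * z' + 'X * vy v) Y 0.
  have -> : vx v - 'X * z' + 'X * vy v = vx v - 'X * ('X * vz v).
    by rewrite /z' /aff /=; ring.
  apply: (@small_lead0 _ (Y - 1)); last by lia.
  apply: smallD => //; apply: smallN; have h := smallXM (smallXM hz).
  by apply: small_le h _; lia.
have hx0 : lead (vx v) (Y + 1) 0 by apply: small_lead0 hx _; lia.
have -> : vy (block 0 1 c.+2 v) =
    aff c.+1 (vx v - 'X * z') (vx v - 'X * z' + 'X * vy v) by rewrite -affSr.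
by apply: lead_cast (lead_blocky _ hx0 hz' hy1) _ _ => //; lia.
Qed.

(* [w = x - y - q^2 z] is what each further [s2] adds after the first letter
   [s3]: the new y is [[c]_q w + y]. *)
Lemma blocky_01_sub c v d tau : (0 < c)%N ->
  lead (vx v - vy v - 'X * ('X * vz v)) d tau ->
  lead (vy (block 0 1 c v) - vy v) (d + c%:Z - 1) tau.
Proof.
case: c => // c _; set w := _ - _ => hw.
have step t : vx v - 'X * aff 1 (vy v) (vz v) + 'X * t - vy v =
    w + 'X * (t - vy v) by rewrite /w /aff /=; ring.
elim: c => [|c IH].
  rewrite /= {1}/aff /= step subrr mulr0 addr0.
  by apply: lead_cast hw _ _ => //; lia.
rewrite /= {1}/aff iterS -/(aff _ _ _) step.
have hw0 : lead w (d + c.+1%:Z - 1 + 1) 0 by apply: lead_lt hw _; lia.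
by apply: lead_cast (leadD hw0 (leadXM IH)) _ _; [lia | rewrite add0r].
Qed.

Lemma z01_neq0 v Y eta : eta != 0 -> lead (vy v) Y eta ->
  small (vz v) (Y - 3) -> aff 1 (vy v) (vz v) != 0.
Proof.
move=> eta0 hy hz; apply: lead_neq0 eta0.
rewrite /aff /= -[eta]addr0; apply: leadD => //; first exact: hy.
by have h := smallXM hz; apply: small_lead0 h _; lia.
Qed.
End Block.

(** * Words without forbidden factors *)

(* Each field from [adm_10] on is annotated with the factor, in generator
   indices, that a minimal form not divisible by Delta does not have. *)
Record admissible (n : nat) (a b c : nat -> nat) : Prop := Admissible {
  adm_ab : forall p, (1 < p <= n)%N -> (0 < a p + b p)%N;
  adm_c : forall p, (0 < p < n)%N -> (0 < c p)%N;
  adm_01 : forall p, (0 < p < n)%N -> a p = 0%N -> b p = 1%N -> (2 < c p)%N;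
  adm_1_01 : forall p, (0 < p)%N -> (p.+1 < n)%N -> c p = 1%N ->
    a p.+1 = 0%N -> b p.+1 = 1%N -> (a p + 1 < c p.+1)%N;
  adm_gt : forall p, (0 < p < n)%N -> (0 < b p)%N ->
    (b p < a p)%N \/ a p = 1%N /\ b p = 1%N -> c p = 1%N -> a p.+1 <> 2%N;
  (* 2 1 2 *)
  adm_10 : forall p, (0 < p < n)%N -> a p.+1 = 1%N -> b p.+1 = 0%N ->
    c p.+1 = 0%N;
  (* 3 2 1^k 3 *)
  adm_b : forall p, (0 < p < n)%N -> (0 < b p)%N -> c p = 1%N -> b p.+1 = 0%N;
  (* 3 2^k 3 2 *)
  adm_b01 : forall p, (0 < p < n)%N -> (0 < b p)%N -> a p.+1 = 0%N ->
    b p.+1 = 1%N -> c p.+1 = 0%N;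
  (* 3 2^k 1 3 2 1 *)
  adm_b111 : forall p, (0 < p)%N -> (p.+1 < n)%N -> (0 < b p)%N ->
    a p.+1 = 1%N -> b p.+1 = 1%N -> c p.+1 = 1%N -> a p.+2 = 0%N;
  (* 2 1^k 2 1 *)
  adm_a : forall p, (1 < p < n)%N -> b p = 0%N -> c p = 1%N -> a p.+1 = 0%N;
  (* 3 2 1^k 2 3 2 *)
  adm_b_01 : forall p, (0 < p)%N -> (p.+1 < n)%N -> (0 < b p)%N -> c p = 1%N ->
    b p.+1 = 0%N -> c p.+1 = 1%N -> a p.+2 = 0%N -> b p.+2 = 1%N ->
    c p.+2 = 0%N;
  (* 1 2 1 3 2 1 *)
  adm_Delta : (2 < n)%N -> (0 < a 1)%N -> b 1 = 0%N -> c 1 = 1%N ->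
    a 2 = 1%N -> b 2 = 1%N -> c 2 = 1%N -> a 3 = 0%N
}.

(** * Propagation of the leading term along the blocks *)

Section Walk.
Variables (n : nat) (a b c : nat -> nat).
Hypothesis adm : admissible n a b c.

Definition wstep p v := block (a p) (b p) (c p) v.

Fixpoint walk v p := if p is p'.+1 then wstep p (walk v p') else v.

(** In this configuration y after block [p.+2] is governed by $x - y - q^2 z$, about which the tie
    states record nothing. *)
Definition next_01 p :=
  [/\ c p.+1 = 1%N, a p.+2 = 0%N, b p.+2 = 1%N & (0 < c p.+2)%N].

(* [v] is the row vector after [p] blocks, [Y] and [eta] are the degree and the
   leading coefficient of [vy v]. In [GoodLow] the entry x is smaller than y.
   After a block ending in a single s2 it can be as large: [GoodTie] says that
   the leading term of the next x does not cancel, [GoodCancel] that it cancels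
   but the next one does not. In [GoodZ] the next block has no s1; when it
   starts with s3 s2, its y has the degree of x - y - q^2 z. *)
Variant good p v Y eta : Prop :=
| GoodLow of small (vx v) (Y - 1) & small (vz v) (Y - 2)
    & (a p.+1 = 0%N -> b p.+1 = 1%N -> (0 < c p.+1)%N ->
       small (vz v) (Y - 3) /\ vx v != 0)
    & (a p.+1 = 1%N -> b p.+1 = 1%N -> c p.+1 = 1%N -> (p.+1 < n)%N ->
       small (vz v) (Y - 3))
| GoodTie r of b p.+1 = 0%N & small (vz v) (Y - 1)
    & lead (vx v) Y r & r != eta & ((p.+2 < n)%N -> ~ next_01 p)
| GoodCancel delta of b p.+1 = 0%N & small (vz v) (Y - 1)
    & ((0 < c p.+1)%N -> (2 < a p.+1)%N)
    & lead (vx v - vy v) (Y - 1) delta & delta != eta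
    & ((p.+2 < n)%N -> ~ next_01 p)
| GoodZ of a p.+1 = 0%N & small (vx v) Y & vx v != 0 & small (vz v) (Y - 3)
    & (b p.+1 = 1%N -> (p.+1 < n)%N ->
       exists d tau, [/\ tau != 0,
         lead (vx v - vy v - 'X * ('X * vz v)) d tau
         & Y + 3 <= d + (c p.+1)%:Z]).

Definition Inv p v :=
  exists Y eta, [/\ eta != 0, lead (vy v) Y eta & good p v Y eta].

(** A lone s1 in front of s2 would complete the factor 2 1 2. *)
Lemma next_a p : (0 < p)%N -> (p < n)%N -> b p.+1 = 0%N -> (0 < c p.+1)%N ->
  (1 < a p.+1)%N.
Proof.
move=> p0 pn b0 c0; have := adm_ab adm (p := p.+1).
have := adm_10 adm (p := p); rewrite b0 p0 pn ltnS p0 => h1 h2.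
have {}h2 := h2 isT; have := h1 isT.
by case: (a p.+1) h2 => [|[|k]] // _ /(_ erefl erefl) c1; rewrite c1 in c0.
Qed.

(** After an s3 the extra clauses of [GoodLow] hold vacuously: 3 2^k 3 2 is excluded, and after s1
    s3 s2 the block [p.+2] could contain neither s1 nor s3. *)
Lemma Inv_low_b p v Y eta : (0 < p < n)%N -> (0 < b p)%N -> eta != 0 ->
  lead (vy v) Y eta -> small (vx v) (Y - 1) -> small (vz v) (Y - 2) -> Inv p v.
Proof.
move=> pn b0 eta0 hy hx hz; exists Y, eta; split=> //; apply: GoodLow => //.
  by move=> a1 b1; rewrite (adm_b01 adm pn).
move=> a1 b1 c1 pn1; have := adm_ab adm (p := p.+2).
have a0 : a p.+2 = 0%N by apply: (adm_b111 adm (p := p)) => //; case/andP: pn.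
by rewrite a0 (adm_b adm) ?b1 //; lia.
Qed.

Lemma not_next_01 p : (0 < p < n)%N -> (0 < b p)%N -> c p = 1%N ->
  (p.+2 < n)%N -> ~ next_01 p.
Proof.
move=> pn b0 c1 p2 [c1' a2 b2].
by rewrite (adm_b_01 adm (p := p)) ?(adm_b adm pn) //; lia.
Qed.

(** If the block ends in a single s2, no s1 can follow, as 2 1^k 2 1 is excluded, and the state is
    [GoodZ]. With more s2, y is ahead of x again. *)
Lemma Inv_b0 p v D r : (1 < p < n)%N -> b p = 0%N ->
  r != 0 -> vx v != 0 -> small (vx v) (D + 1) -> small (vz v) (D - 2) ->
  lead (vy v) (D + (c p)%:Z) r ->
  (c p = 1%N -> b p.+1 = 1%N -> (p.+1 < n)%N ->
    exists d tau, [/\ tau != 0, lead (vx v - vy v - 'X * ('X * vz v)) d tau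
      & D + 4 <= d + (c p.+1)%:Z]) -> Inv p v.
Proof.
move=> pn b0 r0 x0 hx hz hy hw; exists (D + (c p)%:Z), r; split=> //.
have c0 : (0 < c p)%N by apply: (adm_c adm); lia.
have [c1|c1] : c p = 1%N \/ (1 < c p)%N by lia.
  apply: GoodZ => //; first exact: (adm_a adm pn b0 c1).
  - by apply: small_le hx _; lia.
  - by apply: small_le hz _; lia.
  move=> b1 p1; have [d [tau [h1 h2 h3]]] := hw c1 b1 p1.
  by exists d, tau; split=> //; lia.
apply: GoodLow.
- by apply: small_le hx _; lia.
- by apply: small_le hz _; lia.
- by move=> *; split=> //; apply: small_le hz _; lia.
- by move=> *; apply: small_le hz _; lia.
Qed.

(* [al] is [a p], or [a p - 1] after an [s1] was spent on leaving the state
   [(1, 1, 0)]. *)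
Lemma Inv_low p al v Y eta : (1 < p < n)%N -> eta != 0 ->
  lead (vy v) Y eta -> small (vx v) (Y - 1) -> small (vz v) (Y - 2) ->
  (al <= a p)%N -> (b p = 0%N -> al = a p) ->
  (0 < al + b p)%N -> (al, b p) != (1, 0)%N -> (al, b p) != (0, 1)%N ->
  (al = 1%N -> b p = 1%N -> c p = 1%N -> small (vz v) (Y - 3)) ->
  Inv p (block al (b p) (c p) v).
Proof.
move=> pn eta0 hy hx hz ale alb ab0 n10 n01 h111.
have c0 : (0 < c p)%N by apply: (adm_c adm); lia.
have hy' := low_y hy hx hz ab0 n10 n01 c0.
have [hx1 hx2] := low_x al hx hy; have [hz1 hz2] := low_z (b p) hz hy.
have t0 := top_coef_neq0 al (b p) eta0.
have [b0|b0] : b p = 0%N \/ (0 < b p)%N by lia.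
  have al1 : (1 < al)%N.
    by move: ab0 n10; rewrite b0 addn0; case: (al) => [|[|]].
  rewrite b0 in hy' hz1 hz2 t0 *.
  apply: (@Inv_b0 p _ (Y + al%:Z - 1) (top_coef al 0 eta)) => //.
  - by apply: aff_neq0_x hx hy _; lia.
  - by apply: hx2; lia.
  - by apply: small_le hz _; lia.
  - by apply: lead_cast hy' _ _; rewrite // maxn0; lia.
  (* As [b p = 0], $x' - y' - q^2 z' = q(z - y) - q^2 z$ has the leading term of $-qy$. The bound on
     [c p.+1] is the second part of condition (i). *)
  move=> c1 b1 p1; exists (Y + 1), (- eta); rewrite oppr_eq0; split=> //.
    rewrite c1 block1_sub /= /aff /=.
    have -> : 'X * (vz v - vy v) - 'X * ('X * vz v) =
       'X * (- vy v) + ('X * vz v - 'X * ('X * vz v)) by ring.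
    rewrite -[- eta]addr0; apply: leadD; first by apply: leadXM; exact: leadN.
    apply: (@small_lead0 _ Y); last by lia.
    have h := smallXM hz; apply: smallD; first by apply: small_le h _; lia.
    by apply: smallN; apply: small_le (smallXM h) _; lia.
  have := adm_1_01 adm (p := p) _ p1 c1 (adm_a adm pn b0 c1) b1.
  by rewrite -alb //; lia.
have pn0 : (0 < p < n)%N by lia.
set Y' := Y + (maxn al (b p))%:Z + (c p)%:Z - 1 in hy'.
have hz' : small (aff (b p) (vy v) (vz v)) (Y' - (c p)%:Z).
  by apply: hz2; rewrite /Y'; lia.
have [c1|c1] : (1 < c p)%N \/ c p = 1%N by lia.
  apply: (Inv_low_b pn0 b0 t0 hy'); first by apply: hx2; rewrite /Y'; lia.
  by apply: small_le hz' _; lia.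
exists Y', (top_coef al (b p) eta); split=> //.
have b1 := adm_b adm pn0 b0 c1.
have hnext : (p.+2 < n)%N -> ~ next_01 p by exact: not_next_01.
(* In the first case x and y have different coefficients in degree [Y']. In the second they agree,
   and the next coefficient of x - y decides. *)
have [E|E] : ((al < b p)%N \/ al = b p /\ (1 < al)%N) \/
    ((b p < al)%N \/ al = 1%N /\ b p = 1%N).
- by move/eqP: n01 => n01; move: ab0; case: (ltngtP al (b p)) => //; lia.
- have [r hr rn] : exists2 r, lead (vx (block al (b p) (c p) v)) Y' r
      & r != top_coef al (b p) eta.
    rewrite /=.
    case: E => [E|[E al1]].
      exists 0; last by rewrite eq_sym.
      have hx' : small (aff al (- 'X * vy v) (vx v)) (Y' - 1).
        by apply: hx2; rewrite /Y'; lia.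
      by apply: small_lead0 hx' _; lia.
    exists (- eta); last by rewrite /top_coef E eqxx -E al1 /=; lia.
    by apply: lead_cast (hx1 _) _ _; rewrite // /Y'; lia.
  apply: (GoodTie b1 _ hr rn hnext).
  by apply: small_le hz' _; lia.
have hE : (b p < al)%N \/ [/\ al = 1, b p = 1 & small (vz v) (Y - 3)]%N.
  case: E => [|[al1 b1']]; first by left.
  by right; split=> //; exact: h111.
have [delta dn hd] := low_diff eta0 hy hx hz b0 hE.
rewrite -c1 in hd.
apply: (GoodCancel b1 _ _ _ dn hnext).
- by apply: small_le hz' _; lia.
(* Condition (ii) excludes exactly two s1; the third one makes up for the degree lost in the
   cancellation. *)
- move=> c0'; have a1 : (1 < a p.+1)%N by apply: next_a => //; lia.
  have : a p.+1 <> 2%N by apply: (adm_gt adm (p := p)) => //; lia.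
  by lia.
by apply: lead_cast hd _ _; rewrite // /Y' c1; lia.
Qed.

Lemma wstep_01 p v : a p = 0%N -> b p = 1%N -> wstep p v = block 0 1 (c p) v.
Proof. by rewrite /wstep => -> ->. Qed.

(** The new z inherits the degree of the old y; the three s2 granted by condition (i) put y two
    degrees ahead of it. *)
Lemma Inv_01 p v Y eta : (1 < p < n)%N -> a p = 0%N -> b p = 1%N ->
  eta != 0 -> lead (vy v) Y eta -> small (vx v) (Y - 1) ->
  small (vz v) (Y - 3) -> Inv p (wstep p v).
Proof.
move=> pn a0 b1 eta0 hy hx hz; have pn0 : (0 < p < n)%N by lia.
have c2 := adm_01 adm pn0 a0 b1; rewrite wstep_01 //.
have hy' := blocky_01 (ltnW c2) hy hx hz.
apply: (Inv_low_b pn0 _ _ hy'); rewrite ?b1 ?oppr_eq0 //.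
  by apply: small_le hx _; lia.
rewrite /= /aff /=; apply: smallD; first by apply: lead_le hy _; lia.
by apply: small_le (smallXM hz) _; lia.
Qed.

Lemma Inv_01_sub p v D d tau : (1 < p < n)%N -> a p = 0%N -> b p = 1%N ->
  small (vx v) D -> small (vy v) D -> small (vz v) (D - 1) ->
  tau != 0 -> lead (vx v - vy v - 'X * ('X * vz v)) d tau ->
  D + 3 <= d + (c p)%:Z -> Inv p (wstep p v).
Proof.
move=> pn a0 b1 hx hy hz tau0 hw hD; have pn0 : (0 < p < n)%N by lia.
have c2 := adm_01 adm pn0 a0 b1; rewrite wstep_01 //.
have c0 : (0 < c p)%N by lia.
have hy0 : lead (vy v) (d + (c p)%:Z - 1) 0 by apply: small_lead0 hy _; lia.
have := leadD (blocky_01_sub c0 hw) hy0; rewrite subrK addr0 => hy'.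
apply: (Inv_low_b pn0 _ tau0 hy'); rewrite ?b1 //.
  by apply: small_le hx _; lia.
rewrite /= /aff /=; apply: smallD; first by apply: small_le hy _; lia.
by apply: small_le (smallXM hz) _; lia.
Qed.

(** The first s1 gives $q(x - y)$, of full degree if the coefficients differ. If they agree, a
    degree is lost, and the second s1 compares [delta] with [eta]. *)
Lemma good_tie_next p v Y eta : (0 < p)%N -> (p < n)%N ->
  lead (vy v) Y eta -> b p.+1 = 0%N -> small (vz v) (Y - 1) ->
  (0 < c p.+1)%N ->
  (exists2 r, lead (vx v) Y r & r != eta) \/
  (2 < a p.+1)%N /\ (exists2 delta, lead (vx v - vy v) (Y - 1) delta
     & delta != eta) ->
  exists D r, [/\ r != 0, lead (vx (wstep p.+1 v)) (D + 1) r,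
    small (vz v) (D - 2) & small (vy v) (D - 1)].
Proof.
move=> p0 pn hy b0 hz c0 [[r hr rn]|[a2 [delta hd dn]]].
  have a1 := next_a p0 pn b0 c0; exists (Y + (a p.+1)%:Z - 1), (r - eta).
  split; first by rewrite subr_eq0.
  - by apply: lead_cast (lead_blockx _ hr hy) _ _ => //; lia.
  - by apply: small_le hz _; lia.
  by apply: lead_le hy _; lia.
exists (Y + (a p.+1)%:Z - 2), (delta - eta).
split; first by rewrite subr_eq0.
- rewrite /=; move: a2; case: (a p.+1) => // k k1; rewrite affSr.
  have -> : - 'X * vy v + 'X * vx v = 'X * (vx v - vy v) by ring.
  have hd' : lead ('X * (vx v - vy v)) Y delta.
    by apply: lead_cast (leadXM hd) _ _ => //; lia.
  by apply: lead_cast (lead_blockx _ hd' hy) _ _ => //; lia.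
- by apply: small_le hz _; lia.
by apply: lead_le hy _; lia.
Qed.

Lemma Inv_tie p v D r : (0 < p)%N -> (p.+1 < n)%N -> b p.+1 = 0%N ->
  r != 0 -> lead (vx (wstep p.+1 v)) (D + 1) r -> small (vz v) (D - 2) ->
  small (vy v) (D - 1) -> ((p.+2 < n)%N -> ~ next_01 p) ->
  Inv p.+1 (wstep p.+1 v).
Proof.
move=> p0 pn b0 r0 hx hz hy hn.
have c0 : (0 < c p.+1)%N by apply: (adm_c adm); lia.
have pn1 : (1 < p.+1 < n)%N by lia.
have hy' : lead (vy (wstep p.+1 v)) (D + (c p.+1)%:Z) r.
  by rewrite /wstep b0; exact: blocky_b0 r0 c0 hx hz hy.
apply: (Inv_b0 pn1 b0 r0 _ _ _ hy'); first exact: lead_neq0 hx r0.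
- exact: lead_small hx.
- by rewrite /= b0.
move=> c1 b1 p2; case: (hn p2); split=> //; first exact: (adm_a adm pn1 b0 c1).
by apply: (adm_c adm); lia.
Qed.

Lemma Inv_step p v : (0 < p)%N -> (p.+1 < n)%N -> Inv p v ->
  Inv p.+1 (wstep p.+1 v).
Proof.
move=> p0 pn [Y [eta [eta0 hy hg]]].
have c0 : (0 < c p.+1)%N by apply: (adm_c adm); lia.
have pn1 : (1 < p.+1 < n)%N by lia.
have pn0 : (p < n)%N by lia.
have ab0 : (0 < a p.+1 + b p.+1)%N by apply: (adm_ab adm); lia.
case: hg => [hx hz h01 h111|r b0 hz hr rn hn|delta b0 hz ha hd dn hn
            |a0 hx x0 hz hw].
- have [[a0 b1]|n01] := eqVneq (a p.+1, b p.+1) (0, 1)%N.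
    by have [hz3 _] := h01 a0 b1 c0; exact: (Inv_01 pn1 a0 b1 eta0 hy hx hz3).
  have n10 : (a p.+1, b p.+1) != (1, 0)%N.
    apply/eqP => -[a1 b0]; have := next_a p0 pn0 b0 c0; lia.
  rewrite /wstep.
  refine (Inv_low pn1 eta0 hy hx hz (leqnn _) _ ab0 n10 n01 _) => //.
  by move=> a1 b1 c1; exact: h111.
- have [D [s [s0 h1 h2 h3]]] := good_tie_next p0 pn0 hy b0 hz c0
    (or_introl (ex_intro2 _ _ r hr rn)).
  exact: (Inv_tie p0 pn b0 s0 h1 h2 h3 hn).
- have [D [s [s0 h1 h2 h3]]] := good_tie_next p0 pn0 hy b0 hz c0
    (or_intror (conj (ha c0) (ex_intro2 _ _ delta hd dn))).
  exact: (Inv_tie p0 pn b0 s0 h1 h2 h3 hn).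
(* In the remaining case [GoodZ], a single s3 calls for the recorded $x - y - q^2 z$, while with
   more s3 the term $-qz$ dominates. *)
have [b1|b1] : b p.+1 = 1%N \/ (1 < b p.+1)%N by lia.
  have [d [tau [tau0 hw' hd]]] := hw b1 pn.
  apply: (Inv_01_sub pn1 a0 b1 hx _ _ tau0 hw' hd); first exact: lead_small hy.
  by apply: small_le hz _; lia.
have hz2 : small (vz v) (Y - 2) by apply: small_le hz _; lia.
have hy' : lead (vy (wstep p.+1 v)) (Y + (b p.+1)%:Z + (c p.+1)%:Z - 1) (- eta).
  by rewrite /wstep a0; exact: blocky_a0 b1 c0 hy hx hz2.
have [/(_ (ltnW b1)) hz' _] := low_z (b p.+1) hz2 hy.
have pn2 : (0 < p.+1 < n)%N by lia.
have [c1|c1] : c p.+1 = 1%N \/ (1 < c p.+1)%N by lia.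
  exists (Y + (b p.+1)%:Z + (c p.+1)%:Z - 1), (- eta); rewrite oppr_eq0.
  split=> //; apply: (GoodTie (r := 0)).
  - by apply: (adm_b adm pn2) => //; lia.
  - by apply: lead_le hz' _; lia.
  - by rewrite /= a0; apply: small_lead0 hx _; lia.
  - by lia.
  by move=> p2; apply: not_next_01 => //; lia.
apply: (Inv_low_b pn2 _ _ hy'); rewrite ?oppr_eq0 //; first lia.
  by rewrite /= a0; apply: small_le hx _; lia.
by apply: lead_le hz' _; lia.
Qed.

(** The last block may lack s2, and then y is unchanged. If it is s3 s2^c, condition (i) does not
    bound c, y may vanish, and x and z serve instead. *)
Lemma Inv_nonmono p v : (0 < p)%N -> n = p.+1 -> Inv p v ->
  nonmono (wstep n v).
Proof.
move=> p0 nE [Y [eta [eta0 hy hg]]]; rewrite nE.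
have pn0 : (p < n)%N by lia.
have ab0 : (0 < a p.+1 + b p.+1)%N by apply: (adm_ab adm); lia.
have [c0|c0] : c p.+1 = 0%N \/ (0 < c p.+1)%N by lia.
  by left; rewrite /wstep c0; exact: lead_neq0 hy eta0.
case: hg => [hx hz h01 h111|r b0 hz hr rn hn|delta b0 hz ha hd dn hn
            |a0 hx x0 hz hw].
- have [[a0 b1]|n01] := eqVneq (a p.+1, b p.+1) (0, 1)%N.
    have [hz3 x0] := h01 a0 b1 c0; right; rewrite wstep_01 //; split=> //.
    exact: z01_neq0 eta0 hy hz3.
  have n10 : (a p.+1, b p.+1) != (1, 0)%N.
    apply/eqP => -[a1 b0]; have := next_a p0 pn0 b0 c0; lia.
  left; apply: lead_neq0 (low_y hy hx hz ab0 n10 n01 c0) _.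
  exact: top_coef_neq0.
- have [D [s [s0 h1 h2 h3]]] := good_tie_next p0 pn0 hy b0 hz c0
    (or_introl (ex_intro2 _ _ r hr rn)).
  by left; rewrite /wstep b0; exact: lead_neq0 (blocky_b0 s0 c0 h1 h2 h3) s0.
- have [D [s [s0 h1 h2 h3]]] := good_tie_next p0 pn0 hy b0 hz c0
    (or_intror (conj (ha c0) (ex_intro2 _ _ delta hd dn))).
  by left; rewrite /wstep b0; exact: lead_neq0 (blocky_b0 s0 c0 h1 h2 h3) s0.
have [b1|b1] : b p.+1 = 1%N \/ (1 < b p.+1)%N by lia.
  by right; rewrite wstep_01 //; split=> //; exact: z01_neq0 eta0 hy hz.
have hz2 : small (vz v) (Y - 2) by apply: small_le hz _; lia.
left; rewrite /wstep a0; apply: lead_neq0 (blocky_a0 b1 c0 hy hx hz2) _.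
by rewrite oppr_eq0.
Qed.

Lemma Inv_walk p v : (0 < p < n)%N -> Inv p (walk v p) -> nonmono (walk v n).
Proof.
move=> /andP[p0 pn]; have [k] : exists k, n = (p + k.+1)%N.
  by exists (n - p).-1; lia.
elim: k p p0 pn => [|k IH] p p0 pn nE hI.
  have nE' : n = p.+1 by lia.
  by have := Inv_nonmono p0 nE' hI; rewrite {2}nE' /= -nE'.
apply: (IH p.+1) => //; try lia.
by apply: Inv_step => //; lia.
Qed.

Lemma walkS v p : walk v p.+1 = wstep p.+1 (walk v p).
Proof. by []. Qed.

(** * Starting vectors and the prefixes that only exchange two states *)

Definition e1 := Vec 1 0 0.
Definition e2 := Vec 0 1 0.
Definition e3 := Vec 0 0 1.

(* The vectors exchanged by the blocks s1 s3 s2^2, up to powers of q. *)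
Definition tieu (k : nat) := Vec 'X^k 'X^k 0.
Definition tiew (l : nat) := Vec 0 (- 'X * 'X^l) 'X^l.

Lemma aff0 m t : aff m 0 t = 'X^m * t.
Proof.
elim: m => [|m IH]; first by rewrite mul1r.
by rewrite /aff iterS -/(aff _ _ _) IH exprS add0r mulrA.
Qed.

(** The first s1 kills x and leaves a multiple of e2, to which the degree estimates apply with one
    s1 less. *)
Lemma block_tieu al b' c' k :
  block al.+1 b' c' (tieu k) = block al b' c' (Vec 0 'X^k 0).
Proof. by rewrite /block /= affSr mulNr addNr. Qed.

Lemma block_e1 a' b' c' (m : nat) :
  block a' b' c' (Vec 'X^m 0 0) =
    Vec 'X^(a' + m) (aff c' 'X^(a' + m) 0) 0.
Proof. by rewrite /block /= mulr0 !aff0 !mulr0 subr0 -exprD. Qed.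

Lemma lead_e1 c' (m : nat) : (0 < c')%N ->
  lead (aff c' 'X^m 0) (m%:Z + c'%:Z - 1) 1.
Proof.
move=> c0; have hx : lead 'X^m (m%:Z - 1 + 1) 1 by rewrite subrK; exact: leadXn.
by apply: lead_cast (lead_aff c0 hx (lead0 _)) _ _; rewrite ?addr0 //; lia.
Qed.

Lemma Inv_e1 p v (m : nat) : (0 < p < n)%N ->
  v = Vec 'X^m (aff (c p) 'X^m 0) 0 ->
  (c p = 1%N -> a p.+1 = 0%N /\ ((p.+1 < n)%N -> b p.+1 <> 1%N)) -> Inv p v.
Proof.
move=> pn -> h1; have c0 := adm_c adm pn.
have hx : lead 'X^m m%:Z 1 := leadXn m.
exists (m%:Z + (c p)%:Z - 1), 1; split=> //; first exact: lead_e1.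
have [c1|c1] : c p = 1%N \/ (1 < c p)%N by lia.
  have [a0 b1] := h1 c1; apply: GoodZ => //=.
  - by apply: lead_le hx _; lia.
  - exact: lead_neq0 hx _.
  - exact: small0.
  by move=> b1' /b1.
apply: GoodLow => //=; first by apply: lead_le hx _; lia.
- exact: small0.
- by split; [exact: small0 | exact: lead_neq0 hx _].
by move=> *; exact: small0.
Qed.

Lemma Inv_tiew p l : b p.+1 = 0%N -> ((p.+2 < n)%N -> ~ next_01 p) ->
  Inv p (tiew l).
Proof.
move=> b0 hn; have hz := leadXn l; exists (l%:Z + 1), (- 1); split=> //=.
  by rewrite mulNr; apply: leadN; exact: leadXM.
apply: (GoodTie (r := 0)) => //=; last exact: lead0.
by apply: lead_le hz _; lia.
Qed.

(* At [q = 1], [s1^a (s2 s1 s3 s2)^j] sends [e2] to a vector with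
   [y = 1, z = - j] or [y = - 1, x = - j]; here a last [s2] has been added. *)
Definition e2_trace v := exists j : nat,
  ((vy v).[1] - (vx v).[1] + (vz v).[1] = 1 /\ (vz v).[1] = - j%:Z) \/
  ((vy v).[1] - (vx v).[1] + (vz v).[1] = - 1 /\ (vx v).[1] = - j%:Z).

Lemma e2_trace_112 v : e2_trace v -> e2_trace (block 1 1 2 v).
Proof.
move=> [j h]; exists j.+1; rewrite /block /aff /=.
rewrite !(hornerD, hornerN, hornerM, hornerX).
case: h => -[h1 h2]; [right|left]; move: h1 h2;
  move: (vx v).[1] (vy v).[1] (vz v).[1] => x y z; lia.
Qed.

(** One of the new outer entries evaluates at [q = 1] to $-(j+1)$, hence is nonzero however many
    exchanges came before. *)
Lemma e2_trace_111 v : e2_trace v ->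
  vx (block 1 1 1 v) != 0 \/ vz (block 1 1 1 v) != 0.
Proof.
move=> [j [] [h1 h2]]; [left|right];
  apply/eqP => /(congr1 (horner^~ 1)); rewrite /aff /= horner0;
  rewrite !(hornerD, hornerN, hornerM, hornerX);
  move: h1 h2; move: (vx v).[1] (vy v).[1] (vz v).[1] => x y z; lia.
Qed.

(** For e1 and e3, each alternative contradicts the shape of a power of [Delta]: the first two in
    the outer rows, the third in the middle row. *)
Definition detected (e e' : vec) := [\/ nonmono (walk e n), nonmono (walk e' n)
  | vx (walk e2 n) != 0 \/ vz (walk e2 n) != 0].

(** A last block s1 s3 s2 sends both states to multiples of e1 or e3, so the middle row must detect
    it. Otherwise one of the two states does. *)
Lemma tie_final p (e e' : vec) k l : (0 < p)%N -> n = p.+1 ->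
  walk e p = tieu k -> walk e' p = tiew l -> e2_trace (walk e2 p) ->
  detected e e'.
Proof.
move=> p0 nE hu hw h2; have pn : (p < n)%N by lia.
have pn0 : (0 < p < n)%N by lia.
have hk := leadXn k; have Xk0 : ('X^k : {poly int}) != 0 := lead_neq0 hk isT.
have ab0 : (0 < a p.+1 + b p.+1)%N by apply: (adm_ab adm); lia.
have [b0|b0] : b p.+1 = 0%N \/ (0 < b p.+1)%N by lia.
  constructor 2; apply: (Inv_walk pn0); rewrite hw; apply: Inv_tiew => //; lia.
have [a0|a0] : a p.+1 = 0%N \/ (0 < a p.+1)%N by lia.
  constructor 1; rewrite nE walkS hu; right.
  rewrite /wstep a0 /block /=; split=> //.
  apply: (lead_neq0 (d := k%:Z + (b p.+1)%:Z - 1) (r := 1)) => //.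
  have hk' : lead 'X^k (k%:Z - 1 + 1) 1 by rewrite subrK.
  by apply: lead_cast (lead_blockz b0 (lead0 _) hk') _ _ => //; lia.
have [c0|c0] : c p.+1 = 0%N \/ (0 < c p.+1)%N by lia.
  by constructor 1; rewrite nE walkS hu; left; rewrite /wstep c0.
have [[a1 b1 c1]|abc] := eqVneq (a p.+1, b p.+1, c p.+1) (1, 1, 1)%N.
  by constructor 3; rewrite nE walkS /wstep a1 b1 c1; exact: e2_trace_111.
constructor 1; rewrite nE walkS hu /wstep.
move: a0; case aE: (a p.+1) => [//|al] _.
rewrite block_tieu; left; set v := Vec _ _ _.
have hx : small (vx v) (k%:Z - 1) by exact: small0.
have hz : small (vz v) (k%:Z - 2) by exact: small0.
have hz3 : small (vz v) (k%:Z - 3) by exact: small0.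
have [[al0 b1]|n01] := eqVneq (al, b p.+1) (0, 1)%N.
  have c1 : (1 < c p.+1)%N.
    by move/eqP: abc; rewrite aE al0 b1; case: (c p.+1) c0 => [|[|]].
  rewrite al0 b1.
  exact: lead_neq0 (blocky_01 c1 (hk : lead (vy v) _ _) hx hz3) _.
have n10 : (al, b p.+1) != (1, 0)%N by rewrite xpair_eqE; lia.
have ab1 : (0 < al + b p.+1)%N by lia.
exact: lead_neq0 (low_y (hk : lead (vy v) _ _) hx hz ab1 n10 n01 c0)
  (top_coef_neq0 _ _ _).
Qed.

Lemma Inv_detected p (e e' : vec) : (0 < p < n)%N -> Inv p (walk e p) ->
  detected e e'.
Proof. by move=> pn h; constructor 1; exact: Inv_walk pn h. Qed.

Lemma Inv_detected' p (e e' : vec) : (0 < p < n)%N -> Inv p (walk e' p) ->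
  detected e e'.
Proof. by move=> pn h; constructor 2; exact: Inv_walk pn h. Qed.

Arguments Inv_detected {p e e'}.
Arguments Inv_detected' {p e e'}.

Lemma detectedC (e e' : vec) : detected e e' -> detected e' e.
Proof. by case=> h; [constructor 2|constructor 1|constructor 3]. Qed.

(** The state [tiew] is a tie in the sense of [GoodTie] unless [next_01] holds. The state [tieu] is
    then followed instead, as its $x - y - q^2 z$ is an explicit monomial. *)
Lemma tie_b0 p (e e' : vec) k l : (0 < p)%N -> (p.+1 < n)%N ->
  walk e p = tieu k -> walk e' p = tiew l -> b p.+1 = 0%N -> detected e e'.
Proof.
move=> p0 p1 hu hw b0; have pn : (0 < p < n)%N by lia.
have [[c1 b1 p2]|h] : [/\ c p.+1 = 1, b p.+2 = 1 & p.+2 < n]%N \/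
    ~ [/\ c p.+1 = 1, b p.+2 = 1 & p.+2 < n]%N by exact: boolp.EM.
  have pn1 : (1 < p.+1 < n)%N by lia.
  have pn2 : (1 < p.+2 < n)%N by lia.
  have a0 := adm_a adm pn1 b0 c1.
  have c2 := adm_1_01 adm (ltn0Sn p) p2 c1 a0 b1.
  have a2 : (1 < a p.+1)%N by apply: next_a => //; lia.
  have pn2' : (0 < p.+2 < n)%N by lia.
  apply: (Inv_detected (p := p.+2)) => //.
  rewrite !walkS hu /(wstep p.+1) b0 c1.
  move: a2 c2; case: (a p.+1) => // al al1 c2; rewrite block_tieu.
  have hk := leadXn k; set x := aff al (- 'X * 'X^k) 0.
  have hx : small x (k%:Z + al%:Z).
    have [|_ h] := @low_x al 0 'X^k k%:Z 1 _ hk; first exact: small0.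
    by apply: h; lia.
  have -> : block al 0 1 (Vec 0 'X^k 0) = Vec x (x + 'X * 'X^k) 0.
    by rewrite /block /x /aff /= mulr0 subr0.
  apply: (@Inv_01_sub _ _ (k%:Z + al%:Z) (k%:Z + 1) (- 1)) => //=.
  - by apply: smallD => //; apply: lead_le (leadXM hk) _; lia.
  - exact: small0.
  - have -> : x - (x + 'X * 'X^k) - 'X * ('X * 0) = - ('X * 'X^k) by ring.
    by apply: leadN; exact: leadXM.
  by lia.
apply: (Inv_detected' pn); rewrite hw; apply: Inv_tiew => // p2 [c1 _ b1 _].
exact: h.
Qed.

(** Before the end, every block except s1 s3 s2^2 brings one of the states into [Inv]. The last
    hypothesis, with 3 2 1^k 3 excluded, rules out s1 s3 s2. *)
Lemma tie_loop m p (e e' : vec) k l : n = (p + m.+1)%N -> (0 < p)%N ->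
  walk e p = tieu k -> walk e' p = tiew l -> e2_trace (walk e2 p) ->
  ((p.+1 < n)%N -> a p.+1 = 1%N -> b p.+1 = 1%N -> c p.+1 = 1%N ->
     a p.+2 = 0%N) -> detected e e'.
Proof.
elim: m p e e' k l => [|m IH] p e e' k l nE p0 hu hw h2 h111.
  by apply: (tie_final p0 _ hu hw h2); rewrite nE addn1.
have p1 : (p.+1 < n)%N by lia.
have pn : (0 < p < n)%N by lia.
have pn1 : (1 < p.+1 < n)%N by lia.
have pn1' : (0 < p.+1 < n)%N by lia.
have hk := leadXn k; have Xk0 : ('X^k : {poly int}) != 0 := lead_neq0 hk isT.
have c0 := adm_c adm pn1'.
have ab0 : (0 < a p.+1 + b p.+1)%N by apply: (adm_ab adm); lia.
have [b0|b0] : b p.+1 = 0%N \/ (0 < b p.+1)%N by lia.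
  exact: tie_b0 hu hw b0.
have [a0|a0] : a p.+1 = 0%N \/ (0 < a p.+1)%N by lia.
  have [b1|b1] : b p.+1 = 1%N \/ (1 < b p.+1)%N by lia.
    (* The letter s3 cancels z and leaves a multiple of e2, which each s2 multiplies by q. *)
    apply: (Inv_detected' pn1'); rewrite walkS hw /wstep a0 b1.
    have -> : block 0 1 (c p.+1) (tiew l) =
        Vec 0 ('X^(c p.+1) * (- 'X * 'X^l)) 0.
      rewrite /block /aff /= mulNr addNr mulr0 subr0 -/(aff _ 0 _).
      by rewrite aff0.
    apply: (@Inv_low_b _ _ ((c p.+1)%:Z + (1 + l%:Z)) (- 1)); rewrite ?b1 //=.
    - have -> : 'X^(c p.+1) * (- 'X * 'X^l) =
          - 'X^(c p.+1 + (1 + l)) :> {poly int}.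
        by rewrite mulNr mulrN !exprD expr1.
      by apply: leadN; apply: lead_cast (leadXn _) _ _ => //; lia.
    - exact: small0.
    - exact: small0.
  apply: (Inv_detected pn); rewrite hu; exists k%:Z, 1; split=> //.
  apply: GoodZ => //=; first exact: lead_small hk; first exact: small0.
  by move=> b1'; rewrite b1' in b1.
have [[a1 b1]|n11] := eqVneq (a p.+1, b p.+1) (1, 1)%N.
  have [c1|[c1|c1]] : c p.+1 = 1%N \/ c p.+1 = 2%N \/ (2 < c p.+1)%N by lia.
  - have := adm_ab adm (p := p.+2); rewrite (h111 p1 a1 b1 c1).
    by rewrite (adm_b adm pn1') ?b1 // p1 /=; lia.
  - apply: detectedC.
    (* The block s1 s3 s2^2 sends [tiew l] to [tieu l.+2] and [tieu k] to [tiew k], so [e] and [e']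
       trade places. *)
    apply: (IH p.+1 e' e l.+2 k); rewrite ?walkS //; first lia.
    + rewrite hw /wstep a1 b1 c1 /block /aff /tieu /tiew /=.
      by congr Vec; rewrite ?exprS; ring.
    + rewrite hu /wstep a1 b1 c1 /block /aff /tieu /tiew /=.
      by congr Vec; ring.
    + by rewrite /wstep a1 b1 c1; exact: e2_trace_112.
    by move=> p2; apply: (adm_b111 adm) => //; rewrite b1.
  apply: (Inv_detected pn1'); rewrite walkS hu /wstep a1 block_tieu b1.
  set v := Vec _ _ _.
  have hx : small (vx v) (k%:Z - 1) by exact: small0.
  have hz3 : small (vz v) (k%:Z - 3) by exact: small0.
  have hy := blocky_01 (ltnW c1) (hk : lead (vy v) _ _) hx hz3.
  apply: (Inv_low_b pn1' _ _ hy); rewrite ?b1 //; first exact: small0.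
  rewrite /= /aff /= mulr0 addr0.
  by apply: lead_le hk _; lia.
apply: (Inv_detected pn1'); rewrite walkS hu /wstep.
move: a0 n11; case aE: (a p.+1) => [//|al] _ n11; rewrite block_tieu.
have n10 : (al, b p.+1) != (1, 0)%N by rewrite xpair_eqE; lia.
have n01 : (al, b p.+1) != (0, 1)%N by move: n11; rewrite !xpair_eqE; lia.
have sm0 d : small 0 d by exact: small0.
by apply: (Inv_low (Y := k%:Z) (eta := 1)) => //=; rewrite ?aE //; lia.
Qed.

(** Without an initial s1 the factor 1 2 1 3 2 1 is absent, so s1 may follow 2 1 3 2. At that point
    e3 has become a multiple of e1, and [Inv_e1] restarts the walk. *)
Lemma start_a0 : (2 < n)%N -> a 1 = 0%N -> b 1 = 0%N -> c 1 = 1%N ->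
  a 2 = 1%N -> b 2 = 1%N -> c 2 = 1%N -> detected e1 e3.
Proof.
move=> n2 a1 b1 c1 a2 b2 c2.
have E3 : walk e3 2 = Vec 'X^2 0 0.
  rewrite !walkS /wstep a1 b1 c1 a2 b2 c2 /block /aff /=.
  by congr Vec; ring.
have pn2 : (0 < 2 < n)%N by lia.
have b3 : b 3 = 0%N by apply: (adm_b adm pn2) => //; lia.
have E : walk e3 3 = Vec 'X^(a 3 + 2) (aff (c 3) 'X^(a 3 + 2) 0) 0.
  by rewrite walkS E3 /wstep block_e1.
have [n3|n3] : n = 3 \/ (3 < n)%N by lia.
  have [c3|c3] : c 3 = 0%N \/ (0 < c 3)%N by lia.
    (* The word is 2 1 3 2 1^k: e3 stays a multiple of e1, but the middle row has $z = q$. *)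
    constructor 3; right.
    rewrite n3 !walkS /wstep b3 a1 b1 c1 a2 b2 c2 /block /aff /=.
    have -> : 0 - 'X * 0 + 'X * 1 + 'X * 0 = 'X^1 :> {poly int} by ring.
    by apply: (lead_neq0 (leadXn 1)).
  by constructor 2; rewrite n3 E; left; exact: lead_neq0 (lead_e1 _ c3) _.
have pn3 : (0 < 3 < n)%N by lia.
have pn3' : (1 < 3 < n)%N by lia.
apply: (Inv_detected' pn3); rewrite E; apply: (Inv_e1 pn3 erefl) => c3.
split=> [|n4 b4]; first exact: (adm_a adm pn3' b3 c3).
have pn4 : (0 < 4 < n)%N by lia.
have := adm_c adm pn4; rewrite (adm_b_01 adm (p := 2)) ?b2 //.
exact: (adm_a adm pn3' b3 c3).
Qed.

Lemma walk_detected : (0 < n)%N -> (0 < a 1 + b 1 + c 1)%N -> detected e1 e3.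
Proof.
move=> n0 abc0.
have E1 : walk e1 1 = Vec 'X^(a 1) (aff (c 1) 'X^(a 1) 0) 0.
  by rewrite walkS /wstep -[e1]/(Vec 'X^0 0 0) block_e1 addn0.
have [n1|n1] : n = 1%N \/ (1 < n)%N by lia.
  have [c1|c1] : (0 < c 1)%N \/ c 1 = 0%N by lia.
    by constructor 1; rewrite n1 E1; left; exact: lead_neq0 (lead_e1 _ c1) _.
  constructor 3; rewrite n1 walkS /wstep /block /=.
  have h1 := leadXn 0; have [a0|b0] : (0 < a 1)%N \/ (0 < b 1)%N by lia.
    left; rewrite mulr1; apply: (lead_neq0 (d := (a 1)%:Z) (r := - 1)) => //.
    have [|h _] := @low_x (a 1) 0 1 0 1 _ h1; first exact: small0.
    by have := h a0; rewrite add0r mulr1.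
  right; have [|h _] := @low_z (b 1) 1 0 0 1 _ h1; first exact: small0.
  exact: lead_neq0 (h b0) _.
have pn1 : (0 < 1 < n)%N by lia.
have c0 := adm_c adm pn1.
have [c1|c1] : (1 < c 1)%N \/ c 1 = 1%N by lia.
  by apply: (Inv_detected pn1); apply: (Inv_e1 pn1 E1) => c1'; lia.
have [b0|b0] : (0 < b 1)%N \/ b 1 = 0%N by lia.
  have E3 : walk e3 1 = tiew (b 1).
    rewrite walkS /wstep c1 /block mulr0 !aff0 mulr0 mulr1.
    by rewrite /aff /= /tiew; congr Vec; ring.
  apply: (Inv_detected' pn1); rewrite E3; apply: Inv_tiew.
    exact: (adm_b adm pn1).
  by move=> n3; exact: not_next_01.
have [[a0 n2 a2 b2 c2]|h] : [/\ a 1 = 0, 2 < n, a 2 = 1, b 2 = 1 & c 2 = 1]%N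
    \/ ~ [/\ a 1 = 0, 2 < n, a 2 = 1, b 2 = 1 & c 2 = 1]%N by exact: boolp.EM.
  exact: start_a0.
apply: (@tie_loop (n - 2) 1 e1 e3 (a 1) 0) => //; first lia.
- by rewrite E1 c1 /aff /= mulr0 addr0.
- rewrite walkS /wstep b0 c1 /block mulr0 !aff0 mulr0.
  by rewrite /aff /tiew /=; congr Vec; ring.
- exists 0%N; left; rewrite walkS /wstep b0 c1 /block /aff /=.
  rewrite !(hornerD, hornerN, hornerM, hornerX, hornerC, horner0).
  by split; lia.
move=> n2 a2 b2 c2; apply: (adm_Delta adm) => //.
by case: (posnP (a 1)) => // a0; case: h; split.
Qed.
End Walk.

(** * The Burau representation *)

Definition letter (i : 'I_3) (v : vec) : vec :=
  let: Vec x y z := v in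
  match val i with
  | 0%N => Vec ('X * (x - y)) y z
  | 1%N => Vec x (x - 'X * z + 'X * y) z
  | _ => Vec x y (y + 'X * z)
  end.

Definition act (v : vec) (w : seq 'I_3) := foldl (fun v i => letter i v) v w.

Lemma act_cat v (w w' : seq 'I_3) : act v (w ++ w') = act (act v w) w'.
Proof. exact: foldl_cat. Qed.

Lemma act_nseq1 m v :
  act v (nseq m s1) = Vec (aff m (- 'X * vy v) (vx v)) (vy v) (vz v).
Proof.
elim: m v => [|m IH] [x y z] //=; rewrite IH affSr /=; congr Vec; congr aff.
by rewrite mulNr mulrBr addrC.
Qed.

Lemma act_nseq2 m v :
  act v (nseq m s2) = Vec (vx v) (aff m (vx v - 'X * vz v) (vy v)) (vz v).
Proof. by elim: m v => [|m IH] [x y z] //=; rewrite IH affSr. Qed.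

Lemma act_nseq3 m v :
  act v (nseq m s3) = Vec (vx v) (vy v) (aff m (vy v) (vz v)).
Proof. by elim: m v => [|m IH] [x y z] //=; rewrite IH affSr. Qed.

Lemma act_block_word n a b c v : act v (block_word n a b c) = walk a b c v n.
Proof.
elim: n => [//|n IH]; rewrite /block_word.
have -> : iota 1 n.+1 = iota 1 n ++ [:: n.+1].
  by have := iotaD 1 n 1; rewrite addn1 add1n.
rewrite map_cat flatten_cat act_cat -/(block_word n a b c) IH /= cats0.
by rewrite !act_cat act_nseq1 act_nseq3 act_nseq2.
Qed.

Local Notation "p %:F" := (@FracField.tofrac {poly int} p).

Definition represents (r : 'rV[laurent]_3) (v : vec) :=
  [/\ val (r 0 (0 : 'I_3)) = (vx v)%:F, val (r 0 (1 : 'I_3)) = (vy v)%:F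
    & val (r 0 (2 : 'I_3)) = (vz v)%:F].

Lemma represents_letter (r : 'rV[laurent]_3) v i : represents r v ->
  represents (r *m burau_mx i) (letter i v).
Proof.
case: v => x y z [/= hx hy hz].
have [E0 E1 E2] : [/\ (r *m burau_mx i) 0 0 =
    r 0 0 * burau_mx i 0 0 + r 0 1 * burau_mx i 1 0 + r 0 2 * burau_mx i 2 0,
  (r *m burau_mx i) 0 1 =
    r 0 0 * burau_mx i 0 1 + r 0 1 * burau_mx i 1 1 + r 0 2 * burau_mx i 2 1 &
  (r *m burau_mx i) 0 2 =
    r 0 0 * burau_mx i 0 2 + r 0 1 * burau_mx i 1 2 + r 0 2 * burau_mx i 2 2].
  by split; rewrite mxE !big_ord_recl big_ord0 addr0 addrA;
     congr (_ + _ * _ + _ * _); congr (_ _ _); apply: val_inj.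
rewrite /represents {}E0 {}E1 {}E2 !mxE.
by elim/I3P: i => /=; rewrite hx hy hz ?(tofracD, tofracN, tofracM); split;
  ring.
Qed.

Lemma represents_word (r : 'rV[laurent]_3) v (w : seq 'I_3) : represents r v ->
  represents (r *m burau (pos_braid w)) (act v w).
Proof.
elim: w r v => [|i w IH] r v hr.
  by rewrite /pos_braid big_nil burau1 mulmx1.
rewrite /pos_braid big_cons burauM /= -/(pos_braid w) mulmxA burau_sigma.
by apply: IH; exact: represents_letter.
Qed.

(** * Rows of the powers of the Garside element *)

Definition swap_shape (r : 'rV[laurent]_3) :=
  r 0 1 = 0 /\ (r 0 0 = 0 \/ r 0 2 = 0).
Definition mid_shape (r : 'rV[laurent]_3) := r 0 0 = 0 /\ r 0 2 = 0.

Lemma represents_eq0 (r : 'rV[laurent]_3) v : represents r v ->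
  [/\ r 0 0 = 0 -> vx v = 0, r 0 1 = 0 -> vy v = 0 & r 0 2 = 0 -> vz v = 0].
Proof.
case=> h0 h1 h2; split=> E; [move: h0|move: h1|move: h2];
  rewrite {}E => /esym/eqP;
  by rewrite tofrac_eq0 => /eqP.
Qed.

Lemma mul_burau3 (r : 'rV[laurent]_3) i j :
  (r *m burau_mx i) 0 j =
    r 0 0 * burau_mx i 0 j + r 0 1 * burau_mx i 1 j + r 0 2 * burau_mx i 2 j.
Proof.
rewrite mxE !big_ord_recl big_ord0 addr0 addrA.
by congr (_ + _ * _ + _ * _); congr (_ _ _); apply: val_inj.
Qed.

Lemma mul_Delta (r : 'rV[laurent]_3) :
  let r' := r *m burau Delta in
  [/\ r' 0 0 = q ^+ 3 * r 0 2, r' 0 1 = - q ^+ 2 * r 0 1 & r' 0 2 = q * r 0 0].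
Proof.
rewrite /Delta !burauM /= !burau_sigma !mulmxA.
have next i (r0 : 'rV[laurent]_3) (x y z : laurent) :
    [/\ r0 0 0 = x, r0 0 1 = y & r0 0 2 = z] ->
    let r' := r0 *m burau_mx i in
    [/\ r' 0 0 = (if i == s1 then q * x - q * y else x),
        r' 0 1 = (if i == s2 then x + q * y - q * z else y)
      & r' 0 2 = (if i == s3 then y + q * z else z)].
  move=> [<- <- <-]; rewrite /= !mul_burau3 !mxE.
  by elim/I3P: i => /=; split; ring.
have h := next s1 _ _ _ _
  (And3 (erefl (r 0 0)) (erefl (r 0 1)) (erefl (r 0 2))).
move: {h}(next s1 _ _ _ _ (next s2 _ _ _ _ (next s1 _ _ _ _ (next s3 _ _ _ _
  (next s2 _ _ _ _ h))))) => /= [-> -> ->]; split; ring.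
Qed.

(** An antidiagonal matrix exchanges the outer columns and keeps the middle one. Which outer entry
    vanishes depends on the parity of [m], hence the disjunction in [swap_shape]. *)
Lemma shape_Delta m (r : 'rV[laurent]_3) :
  (swap_shape r -> swap_shape (r *m burau (Delta ^+ m)%g)) /\
  (mid_shape r -> mid_shape (r *m burau (Delta ^+ m)%g)).
Proof.
elim: m r => [|m IH] r; first by rewrite expg0 burau1 mulmx1.
rewrite expgS burauM /= mulmxA; have [IH1 IH2] := IH (r *m burau Delta).
have [h0 h1 h2] := mul_Delta r.
split=> [[r1 r02]|[r0 r2]].
  apply: IH1; split; first by rewrite h1 r1 mulr0.
  by case: r02 => E; [right; rewrite h2 E mulr0 | left; rewrite h0 E mulr0].
by apply: IH2; split; rewrite ?h0 ?h2 ?r0 ?r2 mulr0.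
Qed.

(** * Determinants and word length *)

Definition burau_det (g : B4) : laurent := \det (burau g).

Lemma burau_detM : {morph burau_det : g h / (g * h)%g >-> g * h}.
Proof. by move=> g h; rewrite /burau_det burauM det_mulmx. Qed.

Lemma burau_det1 : burau_det 1%g = 1.
Proof. by rewrite /burau_det burau1 det1. Qed.

Lemma burau_detX g m : burau_det (g ^+ m)%g = burau_det g ^+ m.
Proof.
elim: m => [|m IH]; first by rewrite expg0 burau_det1.
by rewrite expgS burau_detM IH exprS.
Qed.

Lemma burau_det_sigma i : burau_det (sigma i) = q.
Proof.
rewrite /burau_det burau_sigma (expand_det_row _ 0) !big_ord_recl big_ord0.
rewrite /cofactor !(expand_det_row _ (0 : 'I_2)) !big_ord_recl !big_ord0.
by rewrite /cofactor !det_mx11 !mxE; elim/I3P: i => /=; ring.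
Qed.

Lemma burau_det_pos (w : seq 'I_3) : burau_det (pos_braid w) = q ^+ size w.
Proof.
elim: w => [|i w IH]; first by rewrite /pos_braid big_nil burau_det1.
rewrite /pos_braid big_cons burau_detM -/(pos_braid w) IH burau_det_sigma.
by rewrite exprS.
Qed.

Lemma burau_det_Delta : burau_det Delta = q ^+ 6.
Proof. by rewrite /Delta !burau_detM !burau_det_sigma; ring. Qed.

Lemma q_expr_inj : injective (fun m : nat => q ^+ m).
Proof.
move=> m k /(congr1 laurent_val); have E i : laurent_val (q ^+ i) = ('X^i)%:F.
  by elim: i => [|i IH]; rewrite ?tofrac1 // !exprS tofracM -IH.
rewrite !E => /eqP; rewrite tofrac_eq => /eqP.
move=> /(congr1 (fun p : {poly int} => size p)).
by rewrite !size_polyXn => -[].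
Qed.

(** * Minimal forms *)

Lemma pos_braid_cat (w w' : seq 'I_3) :
  pos_braid (w ++ w') = (pos_braid w * pos_braid w')%g.
Proof. exact: big_cat. Qed.

Lemma pos_braid_cons i (w : seq 'I_3) :
  pos_braid (i :: w) = (sigma i * pos_braid w)%g.
Proof. exact: big_cons. Qed.

Lemma pos_braid_nseq m i : pos_braid (nseq m i) = (sigma i ^+ m)%g.
Proof.
elim: m => [|m IH]; first by rewrite /pos_braid big_nil expg0.
by rewrite /= pos_braid_cons IH expgS.
Qed.

(** Exchanging the factor gives another expansion of [x] with the same prefix, so minimality
    compares the letters right after it. *)
Lemma minimal_form_factor (x : B4) (w pre post u u' : seq 'I_3) i j :
  minimal_form x w ->
  w = pre ++ i :: u ++ post -> pos_braid (i :: u) = pos_braid (j :: u') ->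
  (i <= j)%N.
Proof.
move=> [wx wmin] wE E.
have : pos_braid (pre ++ j :: u' ++ post) = x.
  rewrite -wx wE -!cat_cons !pos_braid_cat; congr (_ * (_ * _))%g.
  by rewrite E.
move/wmin; rewrite {}wE; elim: pre => [|k pre IH] /=.
  by rewrite lexi_cons => /andP[].
by rewrite eqhead_lexiE.
Qed.

Section BraidRelations.
Local Open Scope group_scope.
Let g1 := sigma s1.
Let g2 := sigma s2.
Let g3 := sigma s3.

(** The braid relation reads $h(gh) = (gh)g$, and conjugation by $gh$ respects powers. *)
Lemma braid_pow (G : groupType) (g h : G) m : g * h * g = h * g * h ->
  h ^+ m * g * h = g * h * g ^+ m.
Proof.
move=> gh; elim: m => [|m IH]; first by rewrite !expg0 mul1g mulg1.
by rewrite expgS -!mulgA (mulgA _ g) IH expgS !mulgA gh.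
Qed.

(** Used to rewrite 3 2^k 3 2 and 2 1^k 2 1 as words with a smaller first index. *)
Lemma braid_pow' (G : groupType) (g h : G) m : g * h * g = h * g * h ->
  g * h ^+ m.+1 * g * h = h * g * h * h * g ^+ m.
Proof.
move=> gh; have E : g * (g * h * g ^+ m.+1) = g * (g * h * g) * g ^+ m.
  by rewrite expgS !mulgA.
by rewrite -!mulgA (mulgA (h ^+ _)) braid_pow // E gh !mulgA gh.
Qed.

Lemma sigma3_pow1 m : g3 * g1 ^+ m = g1 ^+ m * g3.
Proof.
have c31 : commute g3 g1 by rewrite /commute -sigma13.
exact: commuteX.
Qed.

Lemma rel_321k3 m : g3 * g2 * g1 ^+ m * g3 = g2 * g3 * g2 * g1 ^+ m.
Proof. by rewrite -mulgA -sigma3_pow1 mulgA sigma23. Qed.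

Lemma rel_32k1321 m :
  g3 * g2 ^+ m.+1 * g1 * g3 * g2 * g1 = g2 * g3 * g2 * g2 * g3 ^+ m * g1 * g2.
Proof.
rewrite -(braid_pow' m (esym sigma23)) -!mulgA; do 2!congr (_ * _).
by rewrite mulgA sigma13 -mulgA; congr (_ * _); rewrite !mulgA sigma12.
Qed.

Lemma rel_321k232 m :
  g3 * g2 * g1 ^+ m * g2 * g3 * g2 = g2 * g3 * g2 * g1 ^+ m * g2 * g3.
Proof.
rewrite -rel_321k3 -!mulgA; do 3!congr (_ * _).
by rewrite !mulgA sigma23.
Qed.

Lemma rel_121321 : g1 * g2 * g1 * g3 * g2 * g1 = Delta.
Proof.
by rewrite /Delta -!mulgA; do 2!congr (_ * _); rewrite !mulgA -sigma13.
Qed.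

Lemma sigma1_Delta : g1 * Delta = Delta * g3.
Proof.
have E1 : g1 * g2 * g3 * g1 * g2 * g1 = g2 * g1 * g2 * g3 * g2 * g1.
  by rewrite -sigma12 -!mulgA; do 2!congr (_ * _); rewrite !mulgA sigma13.
have E2 : g2 * g1 * g2 * g3 * g2 * g1 = g2 * g1 * (g3 * g2 * g3) * g1.
  by rewrite -sigma23 !mulgA.
have E3 : g2 * g1 * (g3 * g2 * g3) * g1 = g2 * g3 * g1 * g2 * g1 * g3.
  rewrite -!mulgA -sigma13; congr (_ * _); rewrite !mulgA sigma13.
  by [].
rewrite /Delta -!mulgA; congr (_ * _); rewrite !mulgA.
by rewrite E1 E2 E3.
Qed.

End BraidRelations.

Lemma pos_braid_nil : pos_braid [::] = 1%g.
Proof. exact: big_nil. Qed.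

Definition pos_braidE :=
  (pos_braid_cons, pos_braid_cat, pos_braid_nseq, pos_braid_nil).

Lemma nseqSr (T : Type) m (i : T) : nseq m.+1 i = nseq m i ++ [:: i].
Proof. by rewrite -addn1 nseqD. Qed.

Lemma positive_pos_braid (w : seq 'I_3) : positive_braid (pos_braid w).
Proof. by exists w. Qed.

Lemma sigma1_pow_Delta m :
  (sigma s1 ^+ m * Delta = Delta * sigma s3 ^+ m)%g.
Proof.
elim: m => [|m IH]; first by rewrite !expg0 mul1g mulg1.
by rewrite expgSr -mulgA sigma1_Delta mulgA IH -mulgA -expgSr.
Qed.

(** * Factors that a minimal form avoids *)

Section Normal.
Variables (x : B4) (n : nat) (a b c : nat -> nat).
Hypothesis xmin : minimal_form x (block_word n a b c).

Let blk i := nseq (a i) s1 ++ nseq (b i) s3 ++ nseq (c i) s2.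

Lemma block_word_drop p : (0 < p <= n)%N -> exists pre : seq 'I_3,
  block_word n a b c = pre ++ flatten (map blk (iota p (n.+1 - p))).
Proof.
move=> pn; exists (flatten (map blk (iota 1 p.-1))).
rewrite -flatten_cat -map_cat; congr (flatten (map _ _)).
have := iotaD 1 p.-1 (n.+1 - p); rewrite add1n prednK; last by case/andP: pn.
by move=> <-; congr iota; lia.
Qed.

Lemma block_word_split2 p : (0 < p < n)%N -> exists pre post : seq 'I_3,
  block_word n a b c = pre ++ blk p ++ blk p.+1 ++ post.
Proof.
move=> pn; have [|pre ->] := @block_word_drop p; first lia.
exists pre, (flatten (map blk (iota p.+2 (n - p.+1)))).
by have -> : (n.+1 - p = (n - p.+1).+2)%N by lia.
Qed.

Lemma block_word_split3 p : (0 < p)%N -> (p.+1 < n)%N ->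
  exists pre post : seq 'I_3,
  block_word n a b c = pre ++ blk p ++ blk p.+1 ++ blk p.+2 ++ post.
Proof.
move=> p0 pn; have [|pre ->] := @block_word_drop p; first lia.
exists pre, (flatten (map blk (iota p.+3 (n - p.+2)))).
by have -> : (n.+1 - p = (n - p.+2).+3)%N by lia.
Qed.

Lemma no_factor (pre post u u' : seq 'I_3) (i j : 'I_3) :
  block_word n a b c = pre ++ i :: u ++ post -> (j < i)%N ->
  pos_braid (i :: u) <> pos_braid (j :: u').
Proof.
by move=> wE ji /(minimal_form_factor xmin wE); rewrite leqNgt ji.
Qed.

Lemma normal_10 p : (0 < p < n)%N -> (0 < c p)%N ->
  a p.+1 = 1%N -> b p.+1 = 0%N -> c p.+1 = 0%N.
Proof.
move=> pn + a1 b1; have [pre [post]] := block_word_split2 pn.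
rewrite /blk a1 b1; case: (c p) => // k; case: (c p.+1) => // l; rewrite nseqSr.
move=> wE _; exfalso.
apply: (@no_factor (pre ++ nseq (a p) s1 ++ nseq (b p) s3 ++ nseq k s2)
  (nseq l s2 ++ post) [:: s1; s2] [:: s2; s1] s2 s1) => //.
  by rewrite wE /= -!catA.
by rewrite !pos_braidE !mulgA !mulg1 sigma12.
Qed.

Lemma normal_b p : (0 < p < n)%N -> (0 < b p)%N -> c p = 1%N -> b p.+1 = 0%N.
Proof.
move=> pn + c1; have [pre [post]] := block_word_split2 pn.
rewrite /blk c1; case: (b p) => // k; case: (b p.+1) => // l; rewrite nseqSr.
move=> wE _; exfalso.
apply: (@no_factor (pre ++ nseq (a p) s1 ++ nseq k s3)
  (nseq l s3 ++ nseq (c p.+1) s2 ++ post)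
  (s2 :: nseq (a p.+1) s1 ++ [:: s3]) (s3 :: s2 :: nseq (a p.+1) s1)
  s3 s2) => //.
  by rewrite wE /= -!catA /= -?catA.
by rewrite !pos_braidE !mulgA !mulg1 rel_321k3.
Qed.

Lemma normal_b01 p : (0 < p < n)%N -> (0 < c p)%N -> (0 < b p)%N ->
  a p.+1 = 0%N -> b p.+1 = 1%N -> c p.+1 = 0%N.
Proof.
move=> pn + + a1 b1; have [pre [post]] := block_word_split2 pn.
rewrite /blk a1 b1; case: (b p) => // k; case: (c p) => // m.
case: (c p.+1) => // l; rewrite [nseq k.+1 _]nseqSr.
move=> wE _ _; exfalso.
apply: (@no_factor (pre ++ nseq (a p) s1 ++ nseq k s3) (nseq l s2 ++ post)
  (nseq m.+1 s2 ++ [:: s3; s2]) ([:: s3; s2; s2] ++ nseq m s3) s3 s2) => //.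
  by rewrite wE /= -!catA /= -?catA.
by rewrite !pos_braidE !mulgA !mulg1 (braid_pow' m (esym sigma23)).
Qed.

Lemma normal_b111 p : (0 < p)%N -> (p.+1 < n)%N -> (0 < c p)%N ->
  (0 < b p)%N -> a p.+1 = 1%N -> b p.+1 = 1%N -> c p.+1 = 1%N -> a p.+2 = 0%N.
Proof.
move=> p0 pn + + a1 b1 c1; have [pre [post]] := block_word_split3 p0 pn.
rewrite /blk a1 b1 c1; case: (b p) => // k; case: (c p) => // m.
case: (a p.+2) => // l; rewrite [nseq k.+1 _]nseqSr.
move=> wE _ _; exfalso.
apply: (@no_factor (pre ++ nseq (a p) s1 ++ nseq k s3)
  (nseq l s1 ++ nseq (b p.+2) s3 ++ nseq (c p.+2) s2 ++ post)
  (nseq m.+1 s2 ++ [:: s1; s3; s2; s1])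
  ([:: s3; s2; s2] ++ nseq m s3 ++ [:: s1; s2]) s3 s2) => //.
  by rewrite wE /= -!catA /= -?catA.
by rewrite !pos_braidE !mulgA !mulg1 rel_32k1321.
Qed.

(** The block before [p] supplies the first letter of 2 1^k 2 1, whence [1 < p]. *)
Lemma normal_a p : (1 < p < n)%N -> (0 < c p.-1)%N -> (0 < a p)%N ->
  b p = 0%N -> c p = 1%N -> a p.+1 = 0%N.
Proof.
case: p => [//|p] pn /= + + b1 c1.
have [||pre [post]] := @block_word_split3 p; [lia|lia|].
rewrite /blk b1 c1; case: (c p) => // k; case: (a p.+1) => // m.
case: (a p.+2) => // l; rewrite [nseq k.+1 _]nseqSr.
move=> wE _ _; exfalso.
apply: (@no_factor (pre ++ nseq (a p) s1 ++ nseq (b p) s3 ++ nseq k s2)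
  (nseq l s1 ++ nseq (b p.+2) s3 ++ nseq (c p.+2) s2 ++ post)
  (nseq m.+1 s1 ++ [:: s2; s1]) ([:: s2; s1; s1] ++ nseq m s2) s2 s1) => //.
  by rewrite wE /= -!catA /= -?catA.
by rewrite !pos_braidE !mulgA !mulg1 (braid_pow' m (esym sigma12)).
Qed.

Lemma normal_b_01 p : (0 < p)%N -> (p.+1 < n)%N -> (0 < b p)%N -> c p = 1%N ->
  b p.+1 = 0%N -> c p.+1 = 1%N -> a p.+2 = 0%N -> b p.+2 = 1%N ->
  c p.+2 = 0%N.
Proof.
move=> p0 pn + c1 b1 c2 a3 b3; have [pre [post]] := block_word_split3 p0 pn.
rewrite /blk c1 b1 c2 a3 b3; case: (b p) => // k.
case: (c p.+2) => // l; rewrite [nseq k.+1 _]nseqSr.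
move=> wE _; exfalso.
apply: (@no_factor (pre ++ nseq (a p) s1 ++ nseq k s3) (nseq l s2 ++ post)
  (s2 :: nseq (a p.+1) s1 ++ [:: s2; s3; s2])
  ([:: s3; s2] ++ nseq (a p.+1) s1 ++ [:: s2; s3]) s3 s2) => //.
  by rewrite wE /= -!catA /= -?catA.
by rewrite !pos_braidE !mulgA !mulg1 rel_321k232.
Qed.

(** Otherwise the word starts with 1^k 1 2 1 3 2 1, which is [Delta] times 3^k, against the
    maximality of the power of [Delta]. *)
Lemma normal_Delta : (forall t : B4, positive_braid t -> x <> (Delta * t)%g) ->
  (2 < n)%N -> (0 < a 1)%N -> b 1 = 0%N -> c 1 = 1%N ->
  a 2 = 1%N -> b 2 = 1%N -> c 2 = 1%N -> a 3 = 0%N.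
Proof.
move=> xD n2 + b1 c1 a2 b2 c2.
have wE : block_word n a b c =
    blk 1 ++ blk 2 ++ blk 3 ++ flatten (map blk (iota 4 (n - 3))).
  by rewrite /block_word; case: n n2 => [|[|[|m]]] // _; rewrite !subSS subn0.
move: wE; rewrite /blk b1 c1 a2 b2 c2; case: (a 1) => // k.
case: (a 3) => // l; rewrite [nseq k.+1 _]nseqSr => wE _; exfalso.
set post := flatten _ in wE.
pose t := nseq k s3 ++ nseq l s1 ++ nseq (b 3) s3 ++ nseq (c 3) s2 ++ post.
apply: (xD (pos_braid t)); first exact: positive_pos_braid.
have [<- _] := xmin; rewrite wE /t !pos_braidE !mulg1 !mulgA.
by rewrite -sigma1_pow_Delta -rel_121321 expg0 !expg1 expgS !mulgA mulg1.
Qed.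

Lemma normal_admissible :
  (forall t : B4, positive_braid t -> x <> (Delta * t)%g) ->
  (forall i, 2 <= i <= n -> 0 < a i + b i)%N ->
  (forall i, 1 <= i < n -> 0 < c i)%N ->
  (forall p, 1 <= p < n ->
      [/\ a p = 0 -> b p = 1 -> c p <> 1 /\ c p <> 2,
          2 <= p -> a p = 0 -> b p = 1 -> c p <= a p.-1 + 1 -> c p.-1 <> 1,
          0 < b p -> b p + 1 <= a p -> c p = 1 -> a p.+1 <> 2
        & a p = 1 -> b p = 1 -> c p = 1 -> a p.+1 <> 2])%N ->
  admissible n a b c.
Proof.
move=> xD hab hc hn; split.
- exact: hab.
- exact: hc.
- move=> p pn a0 b1; have [h _ _ _] := hn p pn.
  by have [] := h a0 b1; have := hc p pn; lia.
- move=> p p0 pn c1 a0 b1; have [|_ h _ _] := hn p.+1; first lia.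
  by rewrite ltnNge; apply/negP => /(h _ a0 b1); apply.
- move=> p pn b0 hE c1; have [_ _ h h'] := hn p pn.
  by case: hE => [ab|[]]; [apply: h => //; lia | move=> ? ?; exact: h'].
- by move=> p pn; apply: normal_10 => //; exact: hc.
- exact: normal_b.
- by move=> p pn; apply: normal_b01 => //; exact: hc.
- move=> p p0 pn; apply: normal_b111 => //; apply: hc; lia.
- move=> p pn b0 c1; apply: normal_a => //; first by apply: hc; lia.
  by have := hab p; rewrite b0; lia.
- exact: normal_b_01.
exact: normal_Delta.
Qed.
End Normal.

(** * The kernel of the Burau representation *)

Lemma burau_kernel_det (g : B4) k (x : B4) :
  garside_normal_form g k x -> 0 <= k ->
  burau g = 1%g -> g = 1%g.
Proof.
case: k => // m [-> [w ->] _] _ /= h.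
have := congr1 (fun M : GL laurent 3 => \det (M : 'M_3)) h.
rewrite -/(burau_det _) burau_detM burau_detX burau_det_Delta burau_det_pos.
rewrite /= det1 -exprM -exprD -(expr0 q) => /q_expr_inj.
case: m {h} => [|m] //; case: w => //.
by rewrite /pos_braid big_nil expg0 mulg1.
Qed.

Lemma row_represents (w : seq 'I_3) (i : 'I_3) :
  represents (row i (burau (pos_braid w) : 'M_3))
    (act (nth e1 [:: e1; e2; e3] i) w).
Proof.
rewrite rowE; apply: represents_word.
rewrite /represents !mxE.
by elim/I3P: i => /=; split; rewrite ?tofrac0 ?tofrac1.
Qed.

Theorem theorem1p4 (g : B4) (k : int) (x : B4) :
  g <> 1%g -> garside_normal_form g k x ->
  0 <= k \/ normal_braid x ->
  burau g <> 1%g.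
Proof.
move=> g1 gnf knormal g_ker.
have [k0|k0] := leP 0 k; first exact: g1 (burau_kernel_det gnf k0 g_ker).
case: knormal => [|[n [a [b [c [xmin hab hc hn]]]]]]; first by rewrite leNgt k0.
case: k k0 gnf => // m _ [gE _ xD].
have xE : burau x = burau (Delta ^+ m.+1)%g.
  apply: (mulgI (burau (expgz Delta (Negz m)))).
  by rewrite -!burauM -gE g_ker /= mulVg burau1.
have [wx _] := xmin; have adm := normal_admissible xmin xD hab hc hn.
have rep i := row_represents (block_word n a b c) i.
(* By determinants the word has length $6(m+1)$, where [Negz m] is $-(m+1)$. The first block is the
   whole word, or else ends in s2. *)
have n0 : (0 < n)%N /\ (0 < a 1 + b 1 + c 1)%N.
  have : (0 < size (block_word n a b c))%N.
    have := congr1 (fun M : GL laurent 3 => \det (M : 'M_3)) xE.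
    rewrite -!/(burau_det _) -wx burau_det_pos burau_detX burau_det_Delta.
    rewrite -exprM.
    by move=> /q_expr_inj ->.
  case: n hc {xmin hab hn wx adm rep} => [|n] // hc.
  rewrite /block_word /= !size_cat !size_nseq.
  case: n hc => [|n] hc; last first.
    by have := hc 1%N isT; lia.
  by rewrite /=; lia.
have shape (i : 'I_3) := shape_Delta m.+1 (delta_mx 0 i : 'rV[laurent]_3).
have rowE' i : row i (burau (pos_braid (block_word n a b c)) : 'M_3) =
    delta_mx 0 i *m burau (Delta ^+ m.+1)%g.
  by rewrite rowE wx xE.
have [n1 abc0] := n0.
(* The outer rows of a power of [Delta] have y = 0 and a second zero in an outer column, which
   [nonmono] forbids. *)
have nm (i : 'I_3) : i != s2 ->
    ~ nonmono (walk a b c (nth e1 [:: e1; e2; e3] i) n).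
  move=> i1; have := rep i.
  rewrite act_block_word rowE' => /represents_eq0 [hx hy hz].
  have [y0 xz0] : swap_shape (delta_mx 0 i *m burau (Delta ^+ m.+1)%g).
    apply: (shape i).1; rewrite /swap_shape !mxE.
    elim/I3P: i i1 {hx hy hz} => //= _.
      by split; last right.
    by split; last left.
  case=> [|[]]; first by rewrite hy ?eqxx.
  by case: xz0 => [/hx ->|/hz ->]; rewrite eqxx.
case: (walk_detected adm n1 abc0) => [|| h].
- exact: (nm s1).
- exact: (nm s3).
have := rep s2; rewrite act_block_word rowE' => /represents_eq0 [hx hy hz].
have [x0 z0] : mid_shape (delta_mx 0 s2 *m burau (Delta ^+ m.+1)%g).
  by apply: (shape s2).2; rewrite /mid_shape !mxE.
by case: h => /eqP; [apply; exact: hx | apply; exact: hz].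
Qed.
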